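(* Let $\mathbb{F}$ be a field and $\mathcal{A}$ a supersolvable central hyperplane arrangement in $\mathbb{R}^\ell$. Then the associated graded ring $\mathcal{V}_\mathbb{F}(\mathcal{A})$ is Koszul.
   Context: $\mathcal{A}=\{H_1,\dots,H_n\}$, $H_i=\{\mathbf{x}: v_i\cdot\mathbf{x}=0\}$ distinct hyperplanes, $H_i^+=\{v_i\cdot\mathbf{x}>0\}$. $VG_\mathbb{F}(\mathcal{A})$ is the ring of all functions from the set of chambers (connected components of $\mathbb{R}^\ell\setminus\bigcup_iH_i$) to $\mathbb{F}$ with pointwise operations; it is generated by the Heaviside functions $x_i$ ($x_i(C)=1$ if $C\subseteq H_i^+$, else $0$). With $F_d$ the $\mathbb{F}$-span of products of at most $d$ Heaviside functions ($F_{-1}=0$), $\mathcal{V}_\mathbb{F}(\mathcal{A})=\bigoplus_{d\ge0}F_d/F_{d-1}$, a commutative standard graded $\mathbb{F}$-algebra generated in degree $1$. $\mathcal{A}$ is supersolvable if its intersection lattice $\mathcal{L}(\mathcal{A})$ (all intersections of subsets of the hyperplanes, ordered by reverse inclusion) is supersolvable: there is a maximal chain $\Delta$ such that for every chain $K$ the sublattice generated by $\Delta$ and $K$ is distributive. A commutative standard graded $\mathbb{F}$-algebra $R=\mathbb{F}[e_1,\dots,e_n]/I$ ($I$ homogeneous, $\deg e_i=1$) is Koszul if the minimal graded free resolution of $\mathbb{F}=R/R_+$ over $R$ has all nonzero matrix entries of its differentials homogeneous of degree $1$. *)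

(* Defs.v *)
From HB Require Import structures.
From mathcomp Require Import all_boot all_order all_algebra.
From mathcomp Require Import generic_quotient ring_quotient.
From mathcomp Require Import all_classical all_reals topology normedtype.

Set Implicit Arguments.
Unset Strict Implicit.
Unset Printing Implicit Defensive.

Import Order.TTheory GRing.Theory Num.Theory.
Import numFieldNormedType.Exports.

Local Open Scope classical_set_scope.
Local Open Scope ring_scope.
Local Open Scope quotient_scope.

Section Supersolvable.
Context {d : Order.disp_t} (L : latticeType d).

Definition chain (K : set L) : Prop := total_on K (fun x y => (x <= y)%O).

Definition maximal_chain (K : set L) : Prop :=
  chain K /\ forall K' : set L, chain K' -> K `<=` K' -> K' = K.

Definition sublattice (S : set L) : Prop :=
  forall x y, S x -> S y -> S (Order.meet x y) /\ S (Order.join x y).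

Definition generated_sublattice (G : set L) : set L := smallest sublattice G.

Definition distributive_in (S : set L) : Prop :=
  forall x y z, S x -> S y -> S z ->
    Order.meet x (Order.join y z)
      = Order.join (Order.meet x y) (Order.meet x z).

Definition supersolvable : Prop :=
  exists D : set L, maximal_chain D /\
    forall K : set L, chain K ->
      distributive_in (generated_sublattice (D `|` K)).

End Supersolvable.

Section Span.
Context {F : fieldType} {V : lmodType F}.

Definition span (S : set V) : set V :=
  [set v | exists s : seq (F * V),
     (forall p, p \in s -> S p.2) /\ v = \sum_(p <- s) p.1 *: p.2].

Lemma span_ind (S P : set V) :
  P 0 -> (forall a u v, S u -> P v -> P (a *: u + v)) -> span S `<=` P.
Proof.
move=> P0 PS v [s [sS ->]]; elim: s sS => [|p s IH] sS; first by rewrite big_nil.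
rewrite big_cons; apply: PS; first by apply: sS; rewrite mem_head.
by apply: IH => q qs; apply: sS; rewrite in_cons qs orbT.
Qed.

Lemma span0 (S : set V) : span S 0.
Proof. by exists [::]; rewrite big_nil. Qed.

Lemma spanZD (S : set V) a u v : S u -> span S v -> span S (a *: u + v).
Proof.
move=> Su [s [sS ->]]; exists ((a, u) :: s); rewrite big_cons; split=> // p.
by rewrite in_cons => /orP[/eqP->|/sS].
Qed.

Lemma mem_span (S : set V) u : S u -> span S u.
Proof. by move=> Su; rewrite -[u]addr0 -[u]scale1r; apply: spanZD (span0 _). Qed.

Lemma spanD (S : set V) u v : span S u -> span S v -> span S (u + v).
Proof.
move=> Su Sv; move: u Su; apply: span_ind; first by rewrite /mkset add0r.
by move=> a u w Su; rewrite /mkset -addrA; apply: spanZD.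
Qed.

Lemma spanZ (S : set V) a u : span S u -> span S (a *: u).
Proof.
move: u; apply: span_ind; first by rewrite /mkset scaler0; apply: span0.
by move=> b u w Su; rewrite /mkset scalerDr scalerA; apply: spanZD.
Qed.

Lemma spanN (S : set V) u : span S u -> span S (- u).
Proof. by move=> Su; rewrite -scaleN1r; apply: spanZ. Qed.

Lemma span_sum (S : set V) (I : Type) (r : seq I) (f : I -> V) :
  (forall i, span S (f i)) -> span S (\sum_(i <- r) f i).
Proof. by move=> Sf; elim/big_ind: _ => //; [apply: span0|apply: spanD]. Qed.

Lemma span_mono (S T : set V) : S `<=` T -> span S `<=` span T.
Proof.
move=> ST; apply: span_ind; first exact: span0.
by move=> a u v /ST; apply: spanZD.
Qed.

End Span.

Lemma spanM (F : fieldType) (V : comAlgType F) (S T U : set V) :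
  (forall u v, S u -> T v -> U (u * v)) ->
  forall u v, span S u -> span T v -> span U (u * v).
Proof.
move=> STU u v Su Tv; move: u Su.
apply: span_ind; first by rewrite /mkset mul0r; apply: span0.
move=> a u w Su Uw; rewrite /mkset mulrDl -scalerAl; apply: spanD => //.
apply: spanZ; move: v Tv {Uw}.
apply: span_ind; first by rewrite /mkset mulr0; apply: span0.
move=> b v z Tv Uz; rewrite /mkset mulrDr -scalerAr.
by apply: spanZD => //; apply: STU.
Qed.

Definition monomials (F : fieldType) (V : comAlgType F) (n : nat)
    (e : 'I_n -> V) (d : nat) : set V :=
  [set m | exists w : seq 'I_n, size w = d /\ m = \prod_(i <- w) e i].

(* [sga_hom d] is the homogeneous part of degree [d].  The last field says
   that the algebra is a quotient of a polynomial ring in finitely many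
   variables of degree 1; with the others it makes the ideal of relations
   homogeneous.  For d = 0 it gives that the part of degree 0 consists of the
   scalars. *)
Record stdGradedAlg (F : fieldType) := StdGradedAlg {
  sga_alg :> comAlgType F;
  sga_hom : nat -> set sga_alg;
  sga_hom1 : sga_hom 0%N 1;
  sga_homD : forall d a u v,
    sga_hom d u -> sga_hom d v -> sga_hom d (a *: u + v);
  sga_homM : forall d e u v,
    sga_hom d u -> sga_hom e v -> sga_hom (d + e)%N (u * v);
  sga_hom_cover : forall u, exists (m : nat) (c : nat -> sga_alg),
    (forall d, sga_hom d (c d)) /\ u = \sum_(d < m) c d;
  sga_hom_direct : forall (m : nat) (c : nat -> sga_alg),
    (forall d, sga_hom d (c d)) -> \sum_(d < m) c d = 0 ->
    forall d, (d < m)%N -> c d = 0;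
  sga_hom_gen : exists (n : nat) (e : 'I_n -> sga_alg),
    (forall i, sga_hom 1%N (e i)) /\
    (forall d, sga_hom d `<=` span (monomials e d))
}.

Section Koszul.
Variables (F : fieldType) (A : stdGradedAlg F).

Definition irrelevant_ideal : set A :=
  [set u | exists (m : nat) (c : nat -> A),
     (forall d, sga_hom d.+1 (c d)) /\ u = \sum_(d < m) c d].

(* A minimal graded free resolution of A / A_+ as an A-module:
     ... -> A^(mgr_rank 2) -> A^(mgr_rank 1) -> A^(mgr_rank 0) -> A / A_+ -> 0.
   Free modules are spaces of row vectors, on which the differentials act by
   right multiplication, and the k-th basis vector of the i-th module has
   degree [mgr_shift i k].  The augmentation is [u |-> u *m mgr_aug mod A_+].
   Ranks are finite because A is Noetherian. *)
Record minGradedRes := MinGradedRes {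
  mgr_rank : nat -> nat;
  mgr_shift : forall i, 'I_(mgr_rank i) -> nat;
  mgr_aug : 'cV[A]_(mgr_rank 0);
  mgr_diff : forall i, 'M[A]_(mgr_rank i.+1, mgr_rank i);
  mgr_aug_hom : forall j, sga_hom (mgr_shift j) (mgr_aug j 0);
  mgr_diff_hom : forall i j k, mgr_diff i j k != 0 ->
    (mgr_shift k <= mgr_shift j)%N /\
    sga_hom (mgr_shift j - mgr_shift k) (mgr_diff i j k);
  mgr_aug_surj : forall a : A, exists u : 'rV[A]_(mgr_rank 0),
    irrelevant_ideal ((u *m mgr_aug) 0 0 - a);
  mgr_exact0 : forall u : 'rV[A]_(mgr_rank 0),
    irrelevant_ideal ((u *m mgr_aug) 0 0) <->
    exists w : 'rV[A]_(mgr_rank 1), u = w *m mgr_diff 0;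
  mgr_exact : forall i (u : 'rV[A]_(mgr_rank i.+1)),
    u *m mgr_diff i = 0 <->
    exists w : 'rV[A]_(mgr_rank i.+2), u = w *m mgr_diff i.+1;
  mgr_minimal : forall i j k, irrelevant_ideal (mgr_diff i j k)
}.

(* Minimal graded free resolutions exist and are unique up to isomorphism of
   graded complexes, which preserves the degrees of the matrix entries. *)
Definition koszul : Prop :=
  exists M : minGradedRes, forall i j k,
    mgr_diff M i j k != 0 -> sga_hom 1%N (mgr_diff M i j k).

End Koszul.

Section AssociatedGraded.
Variables (F : fieldType) (V : comAlgType F) (n : nat) (x : 'I_n -> V).

Definition filtration (d : nat) : set V :=
  span [set m | exists w : seq 'I_n,
          (size w <= d)%N /\ m = \prod_(i <- w) x i].

(* [filtration_pred d] is F_(d-1), with F_(-1) = 0. *)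
Definition filtration_pred (d : nat) : set V :=
  if d is e.+1 then filtration e else [set 0].

Lemma filtration1 : filtration 0 1.
Proof. by apply: mem_span; exists [::]; rewrite big_nil. Qed.

Lemma filtration_le d e : (d <= e)%N -> filtration d `<=` filtration e.
Proof.
by move=> de; apply: span_mono => m [w [wd ->]]; exists w; split=> //;
   apply: leq_trans de.
Qed.

Lemma filtrationM d e u v :
  filtration d u -> filtration e v -> filtration (d + e)%N (u * v).
Proof.
apply: spanM => {}u {}v [w [wd ->]] [z [ze ->]]; exists (w ++ z).
by rewrite size_cat leq_add // big_cat.
Qed.

Lemma filtration_pred0 d : filtration_pred d 0.
Proof. by case: d => //= d; apply: span0. Qed.

Lemma filtration_predB d u v :
  filtration_pred d u -> filtration_pred d v -> filtration_pred d (u - v).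
Proof.
case: d => [-> ->|d /= du dv]; first by rewrite /= subr0.
by apply: spanD; [exact: du|apply: spanN; exact: dv].
Qed.

Lemma filtration_predM d e u v :
  filtration d u -> filtration_pred e v -> filtration_pred (d + e)%N (u * v).
Proof.
case: e => [du ->|e du ev]; first by rewrite mulr0; apply: filtration_pred0.
by rewrite addnS; apply: filtrationM.
Qed.

Lemma filtration_predD d u v :
  filtration_pred d u -> filtration_pred d v -> filtration_pred d (u + v).
Proof.
move=> du dv; rewrite -[v]opprK; apply: filtration_predB => //.
by rewrite -sub0r; apply: filtration_predB => //; apply: filtration_pred0.
Qed.

(* The direct sum of the F_d, as a subring of V[X]: the polynomials whose
   coefficient of degree d lies in F_d. *)
Definition rees_pred : {pred {poly V}} :=
  fun p => `[< forall d, filtration d p`_d >].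

Lemma rees_subring : subring_closed rees_pred.
Proof.
split=> [|p q /asboolP hp /asboolP hq|p q /asboolP hp /asboolP hq];
  apply/asboolP => d.
- rewrite coef1; case: d => [|d] /=; first exact: filtration1.
  exact: span0.
- by rewrite coefB; apply: spanD; [exact: hp|apply: spanN; exact: hq].
- rewrite coefM; apply: span_sum => i.
  by have := filtrationM (hp i) (hq (d - i)%N); rewrite subnKC // -ltnS.
Qed.

HB.instance Definition _ :=
  GRing.isSubringClosed.Build {poly V} rees_pred rees_subring.

Record rees := Rees { rees_val : {poly V}; rees_valP : rees_val \in rees_pred }.

HB.instance Definition _ := [isSub for rees_val].
HB.instance Definition _ := [Choice of rees by <:].
HB.instance Definition _ := [SubChoice_isSubComNzRing of rees by <:].

Lemma rees_coef (p : rees) d : filtration d (val p)`_d.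
Proof. by have /asboolP := rees_valP p. Qed.

(* The direct sum of the F_(d-1), an ideal of the direct sum of the F_d. *)
Definition rees_ideal : {pred rees} :=
  fun p => `[< forall d, filtration_pred d (val p)`_d >].

Lemma rees_idealP : idealr_closed rees_ideal.
Proof.
split=> [||a u v /asboolP hu /asboolP hv].
- by apply/asboolP => d; rewrite raddf0 coef0; apply: filtration_pred0.
- apply/asboolP => /(_ 0%N); rewrite rmorph1 coef1 => /eqP /=.
  by rewrite oner_eq0.
- apply/asboolP => d; rewrite rmorphD rmorphM /= coefD.
  apply: filtration_predD => //; rewrite coefM.
  elim/big_ind: _ => [|? ?|i _]; [exact: filtration_pred0| |].
    exact: filtration_predD.
  have := filtration_predM (rees_coef a i) (hu (d - i)%N).
  by rewrite subnKC // -ltnS.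
Qed.

HB.instance Definition _ := isIdealr.Build rees rees_ideal rees_idealP.

(* The quotient of the direct sum of the F_d by that of the F_(d-1), i.e.
   the direct sum of the F_d / F_(d-1). *)
Definition gr : Type := {ideal_quot rees_ideal}.

HB.instance Definition _ := GRing.ComNzRing.on gr.

Definition gr_class : rees -> gr := \pi_{ideal_quot rees_ideal}.

HB.instance Definition _ := GRing.RMorphism.on gr_class.


Lemma rees_constP (a : F) : (a%:A)%:P \in rees_pred.
Proof.
apply/asboolP => d; rewrite coefC; case: d => [|d]; last exact: span0.
by apply: spanZ; apply: filtration1.
Qed.

Definition rees_const (a : F) : rees := Rees (rees_constP a).

Definition gr_scale (a : F) (u : gr) : gr := gr_class (rees_const a) * u.

Lemma gr_scaleA a b u : gr_scale a (gr_scale b u) = gr_scale (a * b) u.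
Proof.
rewrite /gr_scale mulrA -rmorphM; congr (gr_class _ * u).
by apply: val_inj; rewrite rmorphM /= -polyCM -scalerAl mul1r scalerA.
Qed.

Lemma gr_scale1 : left_id 1 gr_scale.
Proof.
move=> u; rewrite /gr_scale (_ : rees_const 1 = 1) ?rmorph1 ?mul1r //.
by apply: val_inj; rewrite rmorph1 /= scale1r.
Qed.

Lemma gr_scaleDr : right_distributive gr_scale +%R.
Proof. by move=> a u v; apply: mulrDr. Qed.

Lemma gr_scaleDl u : {morph gr_scale^~ u : a b / a + b}.
Proof.
move=> a b; rewrite /gr_scale -mulrDl -rmorphD; congr (gr_class _ * u).
by apply: val_inj; rewrite rmorphD /= -polyCD scalerDl.
Qed.

HB.instance Definition _ := GRing.Zmodule_isLmodule.Build F gr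
  gr_scaleA gr_scale1 gr_scaleDr gr_scaleDl.

Lemma gr_scaleAl (a : F) (u v : gr) : a *: (u * v) = (a *: u) * v.
Proof. exact: mulrA. Qed.

HB.instance Definition _ := GRing.Lmodule_isLalgebra.Build F gr gr_scaleAl.
HB.instance Definition _ := GRing.Lalgebra_isComAlgebra.Build F gr.

(* The image of F_d / F_(d-1) in the direct sum. *)
Definition gr_hom (d : nat) : set gr :=
  [set u | exists (c : V) (p : rees), val p = c *: 'X^d /\ u = gr_class p].

Lemma rees_monomP d (c : V) : filtration d c -> c *: 'X^d \in rees_pred.
Proof.
move=> dc; apply/asboolP => e; rewrite coefZ coefXn.
by case: eqP => [->|_]; rewrite ?mulr1 ?mulr0 //; apply: span0.
Qed.

Lemma gr_class_eq (p q : rees) :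
  (forall d, filtration_pred d ((val p)`_d - (val q)`_d)) ->
  gr_class p = gr_class q.
Proof.
move=> h; apply/eqP; rewrite -Quotient.idealrBE; apply/asboolP => d.
by rewrite raddfB coefB.
Qed.

Lemma gr_class_eq0 (p : rees) :
  gr_class p = 0 -> forall d, filtration_pred d (val p)`_d.
Proof.
move=> /eqP; rewrite -(rmorph0 gr_class) -Quotient.idealrBE subr0.
by move=> /asboolP.
Qed.

Lemma gr_class_scale a (p : rees) : a *: gr_class p = gr_class (rees_const a * p).
Proof. by rewrite rmorphM. Qed.

Lemma gr_hom1 : gr_hom 0 1.
Proof. by exists 1, 1; rewrite !rmorph1 expr0 scale1r. Qed.

Lemma gr_homD d a u v : gr_hom d u -> gr_hom d v -> gr_hom d (a *: u + v).
Proof.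
move=> [c [p [pE ->]]] [b [q [qE ->]]].
exists (a *: c + b), (rees_const a * p + q); split.
  rewrite rmorphD rmorphM /= pE qE mul_polyC scalerA -scalerDl.
  by rewrite -scalerAl mul1r.
by rewrite gr_class_scale -rmorphD.
Qed.

Lemma gr_homM d e u v : gr_hom d u -> gr_hom e v -> gr_hom (d + e) (u * v).
Proof.
move=> [c [p [pE ->]]] [b [q [qE ->]]]; exists (c * b), (p * q).
by rewrite !rmorphM /= pE qE exprD -scalerAl -scalerAr scalerA.
Qed.

Lemma gr_hom_cover (u : gr) : exists (m : nat) (c : nat -> gr),
  (forall d, gr_hom d (c d)) /\ u = \sum_(d < m) c d.
Proof.
pose p := repr u; pose q d := Rees (rees_monomP (rees_coef p d)).
exists (size (val p)), (fun d => gr_class (q d)); split.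
  by move=> d; exists (val p)`_d, (q d).
rewrite -rmorph_sum -[u]reprK -/p; congr (gr_class _); apply: val_inj.
rewrite raddf_sum /= -[LHS]coefK poly_def.
by apply: eq_bigr.
Qed.

Lemma gr_hom_direct (m : nat) (c : nat -> gr) :
  (forall d, gr_hom d (c d)) -> \sum_(d < m) c d = 0 ->
  forall d, (d < m)%N -> c d = 0.
Proof.
move=> /choice[a] /choice[p] hp s0 d dm.
have pE e : val (p e) = a e *: 'X^e by case: (hp e).
have cE e : c e = gr_class (p e) by case: (hp e).
move: s0; under eq_bigr do rewrite cE; rewrite -rmorph_sum => /gr_class_eq0 h.
rewrite cE -(rmorph0 gr_class); apply: gr_class_eq => e; rewrite raddf0 coef0 subr0.
have {h} := h e; rewrite raddf_sum /= pE coef_sum coefZ coefXn.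
case: eqP => [->|_ _]; last by rewrite mulr0; apply: filtration_pred0.
rewrite (bigD1 (Ordinal dm)) //= pE coefZ coefXn eqxx big1 ?addr0 //.
move=> i /negPf id; rewrite pE coefZ coefXn eq_sym.
by rewrite (_ : (i == d :> nat) = false) ?mulr0.
Qed.

Lemma gr_genP i : x i *: 'X^1 \in rees_pred.
Proof.
by apply: rees_monomP; apply: mem_span; exists [:: i]; rewrite big_seq1.
Qed.

(* The class of [x i] in F_1 / F_0. *)
Definition gr_gen (i : 'I_n) : gr := gr_class (Rees (gr_genP i)).

Lemma gr_hom_gen : exists (m : nat) (e : 'I_m -> gr),
  (forall i, gr_hom 1%N (e i)) /\
  (forall d, gr_hom d `<=` span (monomials e d)).
Proof.
exists n, gr_gen; split=> [i|d _ [c [p [pE ->]]]].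
  by exists (x i), (Rees (gr_genP i)).
have dc : filtration d c.
  by have := rees_coef p d; rewrite pE coefZ coefXn eqxx mulr1.
have main : filtration d `<=` [set c | filtration d c /\
    forall p : rees, val p = c *: 'X^d ->
      span (monomials gr_gen d) (gr_class p)].
  apply: span_ind => [|a m {pE}c [w [wd ->]] [{}dc IH]].
    split; first exact: span0.
    move=> {pE}p; rewrite scale0r => p0; rewrite (_ : p = 0) ?rmorph0.
      exact: span0.
    by apply: val_inj; rewrite rmorph0.
  have dw : filtration d (\prod_(i <- w) x i) by apply: mem_span; exists w.
  split; first by apply: spanD => //; apply: spanZ.
  move=> {}p pE; pose q := Rees (rees_monomP dw); pose r := Rees (rees_monomP dc).
  have -> : p = rees_const a * q + r.
    apply: val_inj; rewrite rmorphD rmorphM /= pE mul_polyC scalerDl scalerA.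
    by rewrite -scalerAl mul1r.
  rewrite rmorphD; apply: spanD; last exact: IH.
  rewrite rmorphM; apply: (@spanZ _ _ _ a (gr_class q)).
  case: (ltnP (size w) d) => [lt_wd|ge_wd].
    rewrite (_ : gr_class q = 0); first exact: span0.
    rewrite -(rmorph0 gr_class); apply: gr_class_eq => e; rewrite raddf0 coef0 subr0 /= coefZ coefXn.
    case: eqP => [->|_]; last by rewrite mulr0; apply: filtration_pred0.
    rewrite mulr1; case: d lt_wd {wd IH dc dw pE q r p} => // d wd.
    by apply: mem_span; exists w.
  have {ge_wd} wd' : size w = d by apply/eqP; rewrite eqn_leq wd.
  apply: mem_span; exists w; split=> //.
  rewrite /gr_gen -rmorph_prod; congr (gr_class _); apply: val_inj.
  rewrite rmorph_prod /= -wd'; elim: (w) => [|i s IHs].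
    by rewrite !big_nil scale1r.
  by rewrite !big_cons -IHs /= exprS -scalerAl -scalerAr scalerA.
by case: (main c dc) => _; apply.
Qed.

Definition gr_sga : stdGradedAlg F :=
  StdGradedAlg gr_hom1 gr_homD gr_homM gr_hom_cover gr_hom_direct gr_hom_gen.

End AssociatedGraded.

Definition dot (R : realType) (l : nat) (v y : 'rV[R]_l) : R :=
  \sum_(j < l) v 0 j * y 0 j.

Definition hyp (R : realType) (l : nat) (v : 'rV[R]_l) : set 'rV[R]_l :=
  [set y | dot v y = 0].

(* The vectors v_i are part of the data: they fix the positive sides. *)
Record arrangement (R : realType) (l : nat) := Arrangement {
  nhyp : nat;
  normal : 'I_nhyp -> 'rV[R]_l;
  normal_neq0 : forall i, normal i != 0;
  normal_hyp_inj : injective (fun i => hyp (normal i))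
}.

Section Arrangement.
Variables (R : realType) (l : nat) (A : arrangement R l).

Definition hyperplane (i : 'I_(nhyp A)) : set 'rV[R]_l := hyp (normal i).

Definition pos_halfspace (i : 'I_(nhyp A)) : set 'rV[R]_l :=
  [set y | 0 < dot (normal i) y].

Definition arr_complement : set 'rV[R]_l := ~` \bigcup_i hyperplane i.

Definition chambers : set (set 'rV[R]_l) :=
  [set connected_component arr_complement y | y in arr_complement].

Definition chamber : Type := set_type chambers.

HB.instance Definition _ := Choice.on chamber.

(* On the moment curve t |-> (1, t, t^2, ...) each linear form v_i is a nonzero
   polynomial, so some point avoids all hyperplanes. *)
Lemma arr_complement_neq0 : exists y, arr_complement y.
Proof.
pose q (i : 'I_(nhyp A)) : {poly R} := \sum_(j < l) normal i 0 j *: 'X^j.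
have qN0 i : q i != 0.
  apply: contra (normal_neq0 i) => /eqP qi0; apply/eqP/rowP => j.
  rewrite mxE -(coef0 R j) -qi0 coef_sum (bigD1 j) //= coefZ coefXn eqxx mulr1.
  rewrite big1 ?addr0 // => k /negPf kj.
  by rewrite coefZ coefXn eq_sym val_eqE kj mulr0.
pose Q := \prod_i q i.
have QN0 : Q != 0 by apply/prodf_neq0.
pose s : seq R := [seq k%:R | k <- iota 0 (size Q)].
have [t tQ] : exists t, ~~ root Q t.
  apply: contrapT => rootQ.
  have : (size s < size Q)%N.
    apply: max_poly_roots => //.
      by apply/allP => t _; apply/negPn/negP => tQ; apply: rootQ; exists t.
    by rewrite map_inj_uniq ?iota_uniq //; apply: mulrIn; rewrite oner_eq0.
  by rewrite size_map size_iota ltnn.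
exists (\row_j t ^+ j) => -[i _]; rewrite /hyperplane /hyp /dot /= => vt0.
move/negP: tQ; apply; rewrite /root /Q (bigD1 i) //= hornerM.
rewrite mulf_eq0; apply/orP; left; apply/eqP; rewrite -[RHS]vt0 horner_sum.
by apply: eq_bigr => j _; rewrite hornerZ hornerXn !mxE.
Qed.

Lemma chamber_inhabited : inhabited chamber.
Proof.
have [y cy] := arr_complement_neq0; apply: inhabits.
by exists (connected_component arr_complement y); rewrite inE; exists y.
Qed.

HB.instance Definition _ :=
  isPointed.Build chamber (inhabited_witness chamber_inhabited).

Definition flats : set (set 'rV[R]_l) :=
  [set \bigcap_(i in S) hyperplane i | S in [set: set 'I_(nhyp A)]].

Definition intersection_lattice : Type := set_type flats.

Local Notation L := intersection_lattice.

HB.instance Definition _ := Choice.on L.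

Definition flat_le (X Y : L) : bool := `[< val Y `<=` val X >].

Lemma flat_le_refl : reflexive flat_le.
Proof. by move=> X; apply/asboolP. Qed.

Lemma flat_le_anti : antisymmetric flat_le.
Proof.
move=> X Y /andP[/asboolP YX /asboolP XY].
by apply: val_inj; apply/seteqP; split.
Qed.

Lemma flat_le_trans : transitive flat_le.
Proof.
move=> Y X Z /asboolP YX /asboolP ZY.
by apply/asboolP; apply: subset_trans YX.
Qed.

Fact flat_display : Order.disp_t. Proof. exact: (Order.Disp tt tt). Qed.

HB.instance Definition _ := Order.Le_isPOrder.Build flat_display L
  flat_le_refl flat_le_anti flat_le_trans.

(* The order is reverse inclusion: the join is the intersection, and the meet
   is the intersection of all the hyperplanes that contain both flats. *)
Lemma flat_joinP (X Y : L) : val X `&` val Y \in flats.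
Proof.
have [S _ <-] := set_mem (valP X); have [T _ <-] := set_mem (valP Y).
by rewrite inE; exists (S `|` T) => //; rewrite bigcap_setU.
Qed.

Definition flat_join (X Y : L) : L := SigSub (flat_joinP X Y).

Lemma flat_meetP (X Y : L) :
  \bigcap_(i in [set i | val X `|` val Y `<=` hyperplane i]) hyperplane i
    \in flats.
Proof. by rewrite inE; eexists; last reflexivity. Qed.

Definition flat_meet (X Y : L) : L := SigSub (flat_meetP X Y).

Lemma flat_lexI (X Y Z : L) :
  (X <= flat_meet Y Z)%O = (X <= Y)%O && (X <= Z)%O.
Proof.
apply/asboolP/andP => [h|[/asboolP YX /asboolP ZX]].
  by split; apply/asboolP => y hy; apply: h => i; apply; [left|right].
move: YX ZX; have [S _ <-] := set_mem (valP X) => YX ZX y hy i Si.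
by apply: hy => z [/YX|/ZX]; apply.
Qed.

Lemma flat_leUx (X Y Z : L) :
  (flat_join X Y <= Z)%O = (X <= Z)%O && (Y <= Z)%O.
Proof.
apply/asboolP/andP => [h|[/asboolP XZ /asboolP YZ]].
  by split; apply/asboolP => y /h[].
by move=> y yZ; split; [apply: XZ|apply: YZ].
Qed.

HB.instance Definition _ := Order.POrder_isMeetSemilattice.Build
  flat_display L flat_lexI.
HB.instance Definition _ := Order.POrder_isJoinSemilattice.Build
  flat_display L flat_leUx.

Variable F : fieldType.

Definition VG : Type := chamber -> F.

HB.instance Definition _ := GRing.ComNzRing.copy VG (chamber -> F).
HB.instance Definition _ := GRing.Lmodule.copy VG (chamber -> F^o).

Lemma VG_scaleAl (a : F) (u v : VG) : a *: (u * v) = (a *: u) * v.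
Proof. by apply/funext => C; apply: mulrA. Qed.

HB.instance Definition _ := GRing.Lmodule_isLalgebra.Build F VG VG_scaleAl.
HB.instance Definition _ := GRing.Lalgebra_isComAlgebra.Build F VG.

Definition heaviside (i : 'I_(nhyp A)) : VG :=
  fun C => if `[< val C `<=` pos_halfspace i >] then 1 else 0.

Definition VG_gr : stdGradedAlg F := gr_sga heaviside.

End Arrangement.

(* Main.v *)
From mathcomp Require Import all_boot all_order all_algebra all_reals.
From mathcomp Require Import all_classical topology normedtype.
From mathcomp Require Import ring lra zify.
Require Import Defs.

(* A modular maximal chain of flats cuts the hyperplanes into levels such that
   two hyperplanes of one level meet inside a hyperplane of lower level.  In the
   graded ring this gives e_i^2 = 0 and, for i, j of the same level, a relation
   e_i e_j = +-e_k e_i +- e_k e_j with k of lower level, so the monomials with at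
   most one factor per level span.  They are linearly independent: along a line
   parallel to the flat of the lower levels, the hyperplanes of one level are
   crossed at distinct points, and the jump of a Heaviside combination at a
   crossing isolates a coefficient.
   Order the generators by level.  With this basis the colon ideal
   (e_1, ..., e_(j-1)) : e_j is generated by the e_i of level at most that of e_j,
   hence again by an initial segment.  So the syzygies of an initial segment have
   linear quotients with colon ideals of the same kind, and iterating this builds
   a linear resolution. *)

Set Implicit Arguments.
Unset Strict Implicit.
Unset Printing Implicit Defensive.

Import Order.TTheory GRing.Theory Num.Theory.
Import numFieldNormedType.Exports.
Local Open Scope classical_set_scope.
Local Open Scope ring_scope.

(** * Linear quotients and Koszulness *)

Section GradedAlgebra.
Variables (F : fieldType) (A : stdGradedAlg F).
Implicit Types (a u v : A) (d : nat).

Lemma sga_hom0 d : sga_hom d (0 : A).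
Proof.
have [m [c [hc _]]] := sga_hom_cover (0 : A).
have := sga_homD (-1) (hc d) (hc d).
by rewrite scaleN1r addNr.
Qed.

Lemma sga_homDr d u v : sga_hom d u -> sga_hom d v -> sga_hom d (u + v).
Proof. by move=> hu hv; rewrite -[u]scale1r; apply: sga_homD. Qed.

Lemma sga_homN d u : sga_hom d u -> sga_hom d (- u).
Proof.
by move=> hu; rewrite -[- u]addr0 -scaleN1r; apply: sga_homD => //; apply: sga_hom0.
Qed.

Lemma sga_hom_sum d (I : Type) (r : seq I) (P : pred I) (f : I -> A) :
  (forall i, P i -> sga_hom d (f i)) -> sga_hom d (\sum_(i <- r | P i) f i).
Proof.
by move=> hf; elim/big_ind: _ => //; [apply: sga_hom0|apply: sga_homDr].
Qed.

(** A sigma type allows components to be selected by [sval]; allowing every [M] past the bound lets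
    finitely many elements share one range of degrees. *)
Lemma sga_components (u : A) :
  {mc : nat * (nat -> A) | (forall d, sga_hom d (mc.2 d)) /\
    forall M, (mc.1 <= M)%N -> u = \sum_(d < M) mc.2 d}.
Proof.
apply: cid; have [m [c [hc ->]]] := sga_hom_cover u.
exists (m, fun d => if (d < m)%N then c d else 0); split=> [d|M mM] /=.
  by case: ifP => // _; apply: sga_hom0.
rewrite -(big_mkord xpredT) -(big_mkord xpredT (fun d => if (d < m)%N then c d else 0)).
rewrite (big_cat_nat (n := m) _ mM) //= [X in _ + X]big_nat_cond [X in _ + X]big1 ?addr0.
  by apply: eq_big_nat => d /andP[_ ->].
by move=> d /andP[/andP[md _] _]; rewrite ltnNge md.
Qed.

Lemma irrelevant0 : irrelevant_ideal (0 : A).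
Proof. by exists 0%N, (fun=> 0); split=> [d|]; rewrite ?big_ord0 //; apply: sga_hom0. Qed.

Lemma irrelevantD u v : irrelevant_ideal u -> irrelevant_ideal v ->
  irrelevant_ideal (u + v).
Proof.
have pad m (c : nat -> A) M : (m <= M)%N ->
    \sum_(d < m) c d = \sum_(d < M) if (d < m)%N then c d else 0.
  move=> mM; rewrite -big_mkcond /= (big_ord_widen_cond M xpredT c mM) //.
move=> [m [c [hc ->]]] [k [b [hb ->]]]; exists (maxn m k).
exists (fun d => (if (d < m)%N then c d else 0) + (if (d < k)%N then b d else 0)).
split=> [d|]; first by apply: sga_homDr; case: ifP => // _; apply: sga_hom0.
by rewrite (pad _ _ _ (leq_maxl m k)) (pad _ b _ (leq_maxr m k)) big_split.
Qed.

Lemma irrelevant_hom d u : sga_hom d.+1 u -> irrelevant_ideal u.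
Proof.
move=> hu; exists d.+1, (fun i => if i == d then u else 0); split=> [i|].
  by case: eqP => [->//|_]; apply: sga_hom0.
by rewrite -big_mkcond /= (big_pred1 (ord_max)) // => i; rewrite /= -val_eqE.
Qed.

Lemma irrelevantMr a u : sga_hom 1 u -> irrelevant_ideal (a * u).
Proof.
move=> hu; have [m [c [hc ->]]] := sga_hom_cover a.
rewrite mulr_suml; elim/big_ind: _ => [||i _]; [exact: irrelevant0|exact: irrelevantD|].
by apply: (@irrelevant_hom i); rewrite -addn1; apply: sga_homM.
Qed.

(* In a linear system whose right-hand side is quadratic, the coefficients may
   be replaced by their components of degree 1. *)
Lemma linear_coefficients j (c : nat -> A) (D : nat -> nat -> A) (f : nat -> A) :
  (forall i k, sga_hom 1 (D i k)) -> (forall k, sga_hom 2 (f k)) ->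
  (forall k, f k = \sum_(i < j) c i * D i k) ->
  exists c' : nat -> A, (forall i, sga_hom 1 (c' i)) /\
    forall k, f k = \sum_(i < j) c' i * D i k.
Proof.
move=> hD hf fE; pose comp i := sval (sga_components (c i)).
have hcomp i d : sga_hom d ((comp i).2 d).
  by have [] := svalP (sga_components (c i)).
have compE i M : ((comp i).1 <= M)%N -> c i = \sum_(d < M) (comp i).2 d.
  by have [_] := svalP (sga_components (c i)); apply.
exists (fun i => (comp i).2 1%N); split=> // k; apply/eqP; rewrite -subr_eq0; apply/eqP.
pose M := (\max_(i < j) (comp i).1).+2.
(* [g d] is the component of degree [d] of [f k - \sum_i c i * D i k], the shift by one coming from
   the linear entries of [D]. These components sum to zero, so directness gives [g 2 = 0], which is
   the claim. *)
pose g d := (if d == 2%N then f k else 0) -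
  (if d is d'.+1 then \sum_(i < j) (comp i).2 d' * D i k else 0).
have hg d : sga_hom d (g d).
  apply: sga_homDr; first by case: eqP => [->//|_]; apply: sga_hom0.
  apply: sga_homN; case: d => [|d]; first exact: sga_hom0.
  by apply: sga_hom_sum => i _; rewrite -addn1; apply: sga_homM.
have g0 : \sum_(d < M.+1) g d = 0.
  rewrite sumrB big_ord_recl /= add0r big_ord_recl /= add0r big_ord_recl /=.
  rewrite big1 ?addr0; last by [].
  apply/eqP; rewrite subr_eq0 big_ord_recl add0r exchange_big /= fE; apply/eqP.
  apply: eq_bigr => i _; rewrite (compE i M) ?mulr_suml //.
  by apply: leqW; apply: leqW; apply: leq_bigmax.
by have := @sga_hom_direct _ _ M.+1 g hg g0 2%N; rewrite /g /=; apply.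
Qed.

End GradedAlgebra.

(** * Initial segments of generators and modules with linear quotients *)

Section LinearQuotients.
Variables (F : fieldType) (A : stdGradedAlg F) (n : nat) (e : nat -> A).

Definition prefix_ideal (t : nat) (a : A) : Prop :=
  exists c : nat -> A, a = \sum_(i < t) c i * e i.

Local Notation I := prefix_ideal.

Lemma prefix_ideal0 t : I t 0.
Proof. by exists (fun=> 0); rewrite big1 // => i _; rewrite mul0r. Qed.

Lemma prefix_idealD t a b : I t a -> I t b -> I t (a + b).
Proof.
move=> [c ->] [d ->]; exists (fun i => c i + d i); rewrite -big_split.
by apply: eq_bigr => i _; rewrite mulrDl.
Qed.

Lemma prefix_idealMl t a b : I t b -> I t (a * b).
Proof.
move=> [c ->]; exists (fun i => a * c i); rewrite mulr_sumr.
by apply: eq_bigr => i _; rewrite mulrA.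
Qed.

Lemma prefix_ideal_nil a : I 0 a -> a = 0.
Proof. by move=> [c ->]; rewrite big_ord0. Qed.

Lemma prefix_idealS t a : I t.+1 a <-> exists b, I t (a - b * e t).
Proof.
split=> [[c ->]|[b [c cE]]].
  by exists (c t), c; rewrite big_ord_recr /= addrK.
exists (fun i => if i == t then b else c i); rewrite big_ord_recr /= eqxx.
rewrite -[a](subrK (b * e t)) cE; congr (_ + _); apply: eq_bigr => i _.
by rewrite (ltn_eqF (ltn_ord i)).
Qed.

Lemma prefix_ideal_gen t i : (i < t)%N -> I t (e i).
Proof.
move=> it; exists (fun k => (k == i)%:R); rewrite (bigD1 (Ordinal it)) //= eqxx mul1r.
by rewrite big1 ?addr0 // => k; rewrite -val_eqE /= => /negPf->; rewrite mul0r.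
Qed.

(* A vector is a function [nat -> A] with finite support, and a matrix with
   [m] rows is a function [nat -> nat -> A] of which only the first [m] rows
   matter. *)
Definition linear_quotients (m : nat) (D : nat -> nat -> A) : Prop :=
  forall j, (j < m)%N -> exists2 t, (t <= n)%N &
    forall a, (exists c : nat -> A, forall k, a * D j k = \sum_(i < j) c i * D i k) <-> I t a.

Definition row_space (m : nat) (D : nat -> nat -> A) (u : nat -> A) : Prop :=
  exists w : nat -> A, forall k, u k = \sum_(i < m) w i * D i k.

(** This is the invariant that passes from a module to its syzygies; iterating it yields a
    resolution with linear matrices. *)
Definition has_linear_quotients (r : nat) (N : (nat -> A) -> Prop) : Prop :=
  exists m D, [/\ forall i k, sga_hom 1 (D i k),
    forall i k, (r <= k)%N -> D i k = 0, linear_quotients m D &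
    forall u, N u <-> row_space m D u].

Lemma eq_has_linear_quotients r N N' : (forall u, N u <-> N' u) ->
  has_linear_quotients r N -> has_linear_quotients r N'.
Proof.
move=> NN' [m [D [lD sD qD rD]]]; exists m, D; split=> // u.
by rewrite -NN'.
Qed.

(** Appending the row [s] leaves the colons of the earlier rows unchanged, and the one new colon is
    [N : s], which is [I t] by assumption. *)
Lemma has_linear_quotients_extend r N s t :
  has_linear_quotients r N -> (forall k, sga_hom 1 (s k)) ->
  (forall k, (r <= k)%N -> s k = 0) -> (t <= n)%N ->
  (forall a, N (fun k => a * s k) <-> I t a) ->
  has_linear_quotients r (fun u => exists a, N (fun k => u k - a * s k)).
Proof.
move=> [m [D [lD sD qD rD]]] ls ss tn Nt.
pose D' i k := if i == m then s k else D i k.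
have D'E (c : nat -> A) j k : (j <= m)%N ->
    \sum_(i < j) c i * D' i k = \sum_(i < j) c i * D i k.
  move=> jm; apply: eq_bigr => i _.
  by rewrite /D' (ltn_eqF (leq_trans (ltn_ord i) jm)).
exists m.+1, D'; split.
- by rewrite /D' => i k; case: eqP.
- by rewrite /D' => i k kr; case: eqP => _; auto.
- move=> j; rewrite ltnS leq_eqVlt => /orP[/eqP->|jm].
    exists t => // a; rewrite -Nt rD; split=> -[c cE]; exists c => k.
      by move: (cE k); rewrite D'E // /D' eqxx.
    by rewrite D'E // {1}/D' eqxx; apply: cE.
  have [t' t'n t'P] := qD j jm; exists t' => // a; rewrite -t'P.
  split=> -[c cE]; exists c => k.
    by move: (cE k); rewrite D'E 1?ltnW // /D' (ltn_eqF jm).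
  by rewrite D'E 1?ltnW // {1}/D' (ltn_eqF jm); apply: cE.
- move=> u; split=> [[a /rD[w wE]]|[w wE]].
    exists (fun i => if i == m then a else w i) => k.
    rewrite big_ord_recr /= /D' eqxx -[LHS](subrK (a * s k)) wE; congr (_ + _).
    by apply: eq_bigr => i _; rewrite (ltn_eqF (ltn_ord i)).
  exists (w m); apply/rD; exists w => k.
  by rewrite wE big_ord_recr /= D'E // /D' eqxx addrK.
Qed.

(** The bound [b_le] keeps each new colon within the range where [colonP] applies again, so the
    construction can be repeated forever. *)
Variable b : nat -> nat.
Hypotheses (e_lin : forall i, sga_hom 1 (e i)) (b_le : forall j, (j < n)%N -> (b j <= n)%N).
Hypothesis colonP : forall j a, (j < n)%N -> I j (a * e j) <-> I (b j) a.
Hypothesis irrP : forall a, irrelevant_ideal a <-> I n a.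

Definition syzygy (m : nat) (D : nat -> nat -> A) (u : nat -> A) : Prop :=
  (forall i, (m <= i)%N -> u i = 0) /\ forall k, \sum_(i < m) u i * D i k = 0.

(* Ordered by their last nonzero coordinate [j] and then by the generators of
   the colon ideal in which that coordinate lies, the syzygies have again
   linear quotients: the new colons are the [I t : e t]. *)
Lemma syzygy_linear_quotients m D : (forall i k, sga_hom 1 (D i k)) ->
  linear_quotients m D -> has_linear_quotients m (syzygy m D).
Proof.
move=> lD qD.
suff H j : (j <= m)%N -> has_linear_quotients m (syzygy j D) by exact: H.
elim: j => [_|j IHj jm].
  exists 0%N, (fun _ _ => 0); split=> [i k|//|//|u]; first exact: sga_hom0.
  split=> [[u0 _]|[w wE]]; first by exists (fun=> 0) => k; rewrite big_ord0 u0.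
  by split=> [i _|k]; rewrite ?wE big_ord0.
have [t0 t0n t0P] := qD j jm.
(* A filtration by the last coordinate: [K 0] is the syzygy module of the first [j] rows, [K t0]
   that of the first [j.+1] rows, and each step in [t] adds one generator. *)
pose K t u := syzygy j.+1 D u /\ I t (u j).
suff H t : (t <= t0)%N -> has_linear_quotients m (K t).
  apply: eq_has_linear_quotients (H t0 (leqnn _)) => u; split=> [[]//|su].
  split=> //; apply/t0P; have [_ uD] := su; exists (fun i => - u i) => k.
  have := uD k; rewrite big_ord_recr /= addrC => /eqP; rewrite addr_eq0 => /eqP->.
  by rewrite -sumrN; apply: eq_bigr => i _; rewrite mulNr.
elim: t => [_|t IHt tt0].
  apply: eq_has_linear_quotients (IHj (ltnW jm)) => u.
  split=> [[u0 uD]|[[u0 uD] /prefix_ideal_nil uj0]].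
    split; last by rewrite u0 //; apply: prefix_ideal0.
    split=> [i /ltnW/u0//|k]; by rewrite big_ord_recr /= u0 // mul0r addr0.
  split=> [i|k].
    by rewrite leq_eqVlt => /orP[/eqP<-//|/u0].
  by have := uD k; rewrite big_ord_recr /= uj0 mul0r addr0.
have tn : (t < n)%N by apply: leq_trans t0n.
have [c0 c0E] : exists c : nat -> A, forall k, e t * D j k = \sum_(i < j) c i * D i k.
  by apply/t0P; apply: prefix_ideal_gen.
(* The left side is a product of two linear elements, hence quadratic; its coefficients can be taken
   linear, and this makes the new syzygy [s] linear. *)
have [c [hc cE]] := linear_coefficients lD (fun k => sga_homM (e_lin t) (lD j k)) c0E.
pose s i := if (i < j)%N then - c i else if i == j then e t else 0.
have sj : s j = e t by rewrite /s ltnn eqxx.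
have sD k : \sum_(i < j.+1) s i * D i k = 0.
  rewrite big_ord_recr /= sj cE -big_split big1 //= => i _.
  by rewrite /s ltn_ord -mulrDl addNr mul0r.
have s0 i : (j < i)%N -> s i = 0.
  by move=> ji; rewrite /s ltnNge ltnW //= gtn_eqF.
have hs i : sga_hom 1 (s i).
  by rewrite /s; case: ifP => _; [apply: sga_homN|case: ifP => _ //; apply: sga_hom0].
have synD u a : syzygy j.+1 D u -> syzygy j.+1 D (fun k => u k - a * s k).
  move=> [u0 uD]; split=> [i ji|k]; first by rewrite u0 // s0 // mulr0 subr0.
  under eq_bigr do rewrite mulrBl -mulrA; rewrite sumrB uD -mulr_sumr sD mulr0.
  by rewrite subr0.
have := has_linear_quotients_extend (IHt (ltnW tt0)) hs _ (b_le tn).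
have s0m k : (m <= k)%N -> s k = 0 by move=> mk; apply: s0; apply: leq_trans mk.
move=> /(_ s0m) ext; apply: (eq_has_linear_quotients _ (ext _)) => [u|a].
  split=> [[a [su It]]|[su /prefix_idealS[a It]]].
    split.
      have := synD _ (- a) su; congr syzygy.
      by apply: boolp.funext => k /=; rewrite mulNr opprK subrK.
    by apply/prefix_idealS; exists a; rewrite -{1}sj.
  by exists a; split; [exact: synD|rewrite sj].
(* Multiples of [s] are always syzygies, so [a * s] lies in [K t] exactly when [a * e t] lies in
   [I t]: the new colon is [I t : e t]. *)
rewrite -colonP //; rewrite /K sj; split=> [[]//|]; split=> //; split=> [i ji|k].
  by rewrite s0 // mulr0.
by under eq_bigr do rewrite -mulrA; rewrite -mulr_sumr sD mulr0.
Qed.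

(** One step of the resolution: rank of the target, number of rows, matrix. Packing them into one
    type lets the resolution be built by iterating a function. *)
Let state : Type := (nat * nat * (nat -> nat -> A))%type.

Let good (st : state) := [/\ forall i k, sga_hom 1 (st.2 i k),
  forall i k, (st.1.1 <= k)%N -> st.2 i k = 0 & linear_quotients st.1.2 st.2].

Let next_state (st st' : state) := [/\ st'.1.1 = st.1.2, good st' &
  forall u, syzygy st.1.2 st.2 u <-> row_space st'.1.2 st'.2 u].

(** The implication makes the statement total in [st], with a junk successor for bad states, so that
    choice gives a function defined on all states. *)
Lemma ex_next_state st : exists st', good st -> next_state st st'.
Proof.
have [[lD sD qD]|ng] := pselect (good st); last by exists st.
have [m' [D' [lD' sD' qD' rD']]] := syzygy_linear_quotients lD qD.
by exists (st.1.2, m', D').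
Qed.

Lemma initial_state_good : good (1%N, n, fun j k => if k == 0%N then e j else 0).
Proof.
split=> /= [i k|i [|k] //|j jn]; first by case: eqP => _ //; apply: sga_hom0.
exists (b j); [exact: b_le|move=> a; rewrite -colonP //].
split=> [[c /(_ 0%N) /= cE]|[c cE]]; exists c => // -[|k] //=.
by rewrite mulr0 big1 // => i _; rewrite mulr0.
Qed.

Lemma koszul_of_linear_quotients : koszul A.
Proof.
have [next nextP] := boolp.choice ex_next_state.
pose st i := iter i next (1%N, n, fun j k => if k == 0%N then e j else 0).
have gst i : good (st i).
  elim: i => [|i IHi]; first exact: initial_state_good.
  by have [] := nextP _ IHi.
pose rk i := (st i).1.1.
have rkS i : rk i.+1 = (st i).1.2 by have [] := nextP _ (gst i).
pose D i : 'M[A]_(rk i.+1, rk i) := \matrix_(j, k) (st i).2 j k.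
have hD i j k : sga_hom 1 (D i j k) by rewrite mxE; have [] := gst i.
(* Extension of a row vector by zero, to pass from matrices to functions on [nat]. *)
pose fn m (u : 'rV[A]_m) k := if insub k is Some i then u 0 i else 0.
have fnE m (u : 'rV[A]_m) (k : 'I_m) : fn m u k = u 0 k by rewrite /fn valK.
have fn0 m (u : 'rV[A]_m) k : (m <= k)%N -> fn m u k = 0.
  by move=> mk; rewrite /fn insubF // ltnNge mk.
have mulE i (u : 'rV[A]_(rk i.+1)) (k : 'I_(rk i)) :
    (u *m D i) 0 k = \sum_(j < rk i.+1) fn _ u j * (st i).2 j k.
  by rewrite mxE; apply: eq_bigr => j _; rewrite fnE !mxE.
have ex i (u : 'rV[A]_(rk i.+1)) :
    u *m D i = 0 <-> exists w : 'rV[A]_(rk i.+2), u = w *m D i.+1.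
  have [_ _ /(_ (fn _ u)) eP] := nextP _ (gst i).
  have -> : u *m D i = 0 <-> syzygy (st i).1.2 (st i).2 (fn _ u).
    rewrite -rkS; split=> [uD|[_ uD]]; last by apply/rowP => k; rewrite mulE uD mxE.
    split=> [k|k]; first exact: fn0.
    case: (ltnP k (rk i)) => [kr|kr]; first by rewrite -(mulE i u (Ordinal kr)) uD mxE.
    by rewrite big1 // => j _; have [_ -> //] := gst i; rewrite mulr0.
  rewrite eP; change (next (st i)) with (st i.+1); rewrite -rkS.
  split=> [[w wE]|[w wE]].
    exists (\row_j w j); apply/rowP => k; rewrite -fnE wE mxE.
    by apply: eq_bigr => j _; rewrite !mxE.
  exists (fn _ w) => k; case: (ltnP k (rk i.+1)) => [kr|kr].
    by rewrite -(mulE _ w (Ordinal kr)) -wE -fnE.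
  rewrite fn0 // big1 // => j _; have [_ -> //] := gst i.+1.
  by rewrite mulr0.
have irr1 (u : A) : sga_hom 1 u -> irrelevant_ideal u.
  exact: irrelevant_hom.
have ex0 (u : 'rV[A]_(rk 0)) : irrelevant_ideal ((u *m const_mx 1 : 'M_1) 0 0) <->
    exists w : 'rV[A]_(rk 1), u = w *m D 0.
  have uE : (u *m const_mx 1 : 'M_1) 0 0 = u 0 0.
    by rewrite mxE big_ord1 mxE mulr1.
  rewrite uE irrP; split=> [[c cE]|[w ->]].
    exists (\row_j c j); apply/rowP => k; rewrite ord1 cE mxE.
    by under [RHS]eq_bigr do rewrite !mxE; rewrite rkS.
  by exists (fn _ w); rewrite mulE; move: (fn _ w) => g; rewrite rkS.
(* All basis vectors of the [i]-th free module have degree [i]; this is the linearity of the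
   resolution. *)
pose M := @MinGradedRes F A rk (fun i _ => i) (const_mx 1) D.
unshelve eexists.
  apply: M => //.
  - by move=> j; rewrite mxE; apply: sga_hom1.
  - by move=> i j k _; rewrite subSnn.
  - move=> a; exists (const_mx a); rewrite mxE big_ord1 !mxE mulr1 subrr.
    exact: irrelevant0.
  - by move=> i j k; apply: irr1.
by move=> i j k _ /=; apply: hD.
Qed.

End LinearQuotients.

(** * Levels of a supersolvable arrangement *)

Section DotProduct.
Variables (R : realType) (l : nat).
Implicit Types v y z : 'rV[R]_l.

Lemma dotDr v y z : dot v (y + z) = dot v y + dot v z.
Proof. by rewrite -big_split; apply: eq_bigr => j _; rewrite mxE mulrDr. Qed.

Lemma dotZr v a y : dot v (a *: y) = a * dot v y.
Proof. by rewrite mulr_sumr; apply: eq_bigr => j _; rewrite mxE mulrCA. Qed.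

Lemma dotBr v y z : dot v (y - z) = dot v y - dot v z.
Proof. by rewrite dotDr -scaleN1r dotZr mulN1r. Qed.

Lemma ex_dot_neq0 v : v != 0 -> exists y, dot v y != 0.
Proof.
move=> v0; apply: contrapT => H; move/eqP: v0; apply; apply/rowP => j; rewrite mxE.
apply: contrapT => /eqP vj; apply: H; exists (delta_mx 0 j).
rewrite /dot (bigD1 j) //= big1 ?addr0 => [|k /negPf kj].
  by rewrite mxE !eqxx mulr1.
by rewrite mxE kj andbF mulr0.
Qed.

End DotProduct.

Section Levels.
Variables (R : realType) (l : nat) (A : arrangement R l).
Local Notation n := (nhyp A).
Local Notation L := (intersection_lattice A).
Implicit Types (X Y Z : L) (i j k : 'I_n).

(** A linear form vanishing on the kernel of another is a multiple of it, here a nonzero one, so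
    both kernels coincide and distinctness applies. *)
Lemma hyperplane_sub_inj i j : hyperplane i `<=` hyperplane j -> i = j.
Proof.
move=> sij; apply: normal_hyp_inj; apply/seteqP; split=> // y.
have [z zi] := ex_dot_neq0 (normal_neq0 i).
have dotj x : dot (normal j) x = dot (normal i) x / dot (normal i) z * dot (normal j) z.
  have : hyperplane j (x - (dot (normal i) x / dot (normal i) z) *: z).
    by apply: sij; rewrite /hyperplane /hyp /= dotBr dotZr divfK ?subrr.
  by rewrite /hyperplane /hyp /= dotBr dotZr => /eqP; rewrite subr_eq0 => /eqP.
have [x xj] := ex_dot_neq0 (normal_neq0 j).
have zj : dot (normal j) z != 0.
  by apply: contra xj => /eqP zj; rewrite dotj zj mulr0.
rewrite /hyp /= dotj => /eqP; rewrite mulf_eq0 (negPf zj) orbF mulf_eq0 invr_eq0.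
by rewrite (negPf zi) orbF => /eqP.
Qed.

Lemma flat_leP X Y : reflect (val Y `<=` val X) (X <= Y)%O.
Proof. exact: asboolP. Qed.

Lemma hyperplane_flatP i : hyperplane i \in flats A.
Proof. by rewrite inE; exists [set i] => //; rewrite bigcap_set1. Qed.

Definition hyperplane_flat i : L := SigSub (hyperplane_flatP i).
Local Notation H := hyperplane_flat.

(** Geometrically the hyperplanes containing [X]; in the lattice they lie below [X]. They determine
    the flat, and their number replaces the rank. *)
Definition hyperplanes_above X : {set 'I_n} := [set i | (H i <= X)%O].
Local Notation B := hyperplanes_above.

Lemma mem_hyperplanes_above i X : (i \in B X) = (H i <= X)%O.
Proof. by rewrite finset.in_set. Qed.

Lemma hyperplanes_aboveS X Y : (B X \subset B Y) = (X <= Y)%O.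
Proof.
apply/idP/idP => [/fintype.subsetP sB|XY].
  have [S _ SX] := set_mem (valP X); apply/flat_leP; rewrite -SX => y yY i Si.
  have : i \in B Y.
    by apply: sB; rewrite mem_hyperplanes_above; apply/flat_leP => z; rewrite -SX; apply.
  by rewrite mem_hyperplanes_above => /flat_leP; apply.
by apply/fintype.subsetP => i; rewrite !mem_hyperplanes_above => /le_trans; apply.
Qed.

Lemma hyperplanes_above_inj : injective B.
Proof.
move=> X Y XY; apply/eqP; rewrite eq_le -!hyperplanes_aboveS XY.
by rewrite subxx.
Qed.

(** Adding [Z] to [D] gives a chain again, so maximality absorbs it. *)
Lemma maximal_chain_mem (D : set L) Z : maximal_chain D ->
  (forall W, D W -> (W <= Z)%O || (Z <= W)%O) -> D Z.
Proof.
move=> [cD mD] DZ; rewrite -(mD (D `|` [set Z])); [by right| |by left].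
move=> X Y [DX|->] [DY|->]; last by left.
- exact: cD.
- by apply/orP; apply: DZ.
- by apply/orP; rewrite orbC; apply: DZ.
Qed.

(** A hyperplane gets its level from [X i], the largest member of the maximal chain that is not
    above [H i]. The first clause comes from distributivity; the second provides the direction of
    the lines used for independence. *)
Lemma supersolvable_levels : supersolvable L -> exists lev : 'I_n -> nat,
  (forall i j, i != j -> lev i = lev j -> exists2 k, (lev k < lev i)%N &
     hyperplane i `&` hyperplane j `<=` hyperplane k) /\
  (forall i, exists u, (forall k, (lev k < lev i)%N -> hyperplane k u) /\
     forall j, lev j = lev i -> ~ hyperplane j u).
Proof.
move=> [D [mD distD]]; have [cD _] := mD.
have Dtotal X Y : D X -> D Y -> (X <= Y)%O || (Y <= X)%O.
  by move=> DX DY; apply/orP; apply: cD.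
have [X0 X0E] : exists X0 : L, val X0 = setT.
  have fT : setT \in flats A by rewrite inE; exists set0 => //; rewrite bigcap_set0.
  by exists (SigSub fT).
have X0le X : (X0 <= X)%O by apply/flat_leP; rewrite X0E.
have HX0 i : ~~ (H i <= X0)%O.
  apply/negP => /flat_leP; rewrite X0E => Hi.
  have [y /eqP] := ex_dot_neq0 (normal_neq0 i); apply.
  exact: (Hi y).
have DX0 : D X0 by apply: maximal_chain_mem mD _ => W _; rewrite X0le orbT.
(* Counting the hyperplanes through a flat turns the search for a largest chain member into a
   bounded maximum over [nat]. *)
have exX i : exists X, [/\ D X, ~~ (H i <= X)%O &
    forall W, D W -> ~~ (H i <= W)%O -> (W <= X)%O].
  pose P (k : nat) := `[< exists X, [/\ D X, ~~ (H i <= X)%O & #|B X| = k] >].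
  have exP : exists k : nat, P k by exists #|B X0|; apply/asboolP; exists X0.
  have leP (k : nat) : P k -> (k <= n)%N.
    by move=> /asboolP[X [_ _ <-]]; rewrite -[X in (_ <= X)%N]card_ord; apply: max_card.
  case: (ex_maxnP exP leP) => k /asboolP[X [DX HX <-]] maxX; exists X; split=> // W DW HW.
  case/orP: (Dtotal _ _ DW DX) => // XW.
  have : B X == B W.
    by rewrite eqEcard hyperplanes_aboveS XW maxX //; apply/asboolP; exists W.
  by move=> /eqP/hyperplanes_above_inj->.
have {exX} [X XP] := boolp.choice exX.
have DX i : D (X i) by case: (XP i).
have HX i : ~~ (H i <= X i)%O by case: (XP i).
have maxX i W : D W -> ~~ (H i <= W)%O -> (W <= X i)%O by case: (XP i) => _ _; apply.
(* The join is comparable with every [W] in the chain: if [W] is above [H i] it is also above [X i],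
   hence above the join; otherwise [W] is below [X i]. *)
have DZ i : D (Order.join (X i) (H i)).
  apply: maximal_chain_mem mD _ => W DW; have [HW|HW] := boolP (H i <= W)%O.
    rewrite leUx HW andbT; case/orP: (Dtotal _ _ (DX i) DW) => [->|WX].
      by rewrite orbT.
    by have := HX i; rewrite (le_trans HW WX).
  by rewrite lexU2 // maxX.
pose lev i := #|B (X i)|.
have levX i j : lev i = lev j -> X i = X j.
  move=> ij; apply: hyperplanes_above_inj; apply/eqP.
  case/orP: (Dtotal _ _ (DX i) (DX j)); rewrite -hyperplanes_aboveS => sB.
    by rewrite eqEcard sB; rewrite /lev in ij; rewrite ij leqnn.
  by rewrite eq_sym eqEcard sB; rewrite /lev in ij; rewrite ij leqnn.
have lev_lt i k : (lev k < lev i)%N = (H k <= X i)%O.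
  apply/idP/idP => [lt_ki|HkX].
    apply/negPn/negP => /(maxX _ _ (DX i)); rewrite -hyperplanes_aboveS.
    by move=> /subset_leq_card; rewrite leqNgt lt_ki.
  apply: proper_card; rewrite finset.properEneq hyperplanes_aboveS.
  case/orP: (Dtotal _ _ (DX i) (DX k)) => [ik|ki].
    by have := HX k; rewrite (le_trans HkX ik).
  rewrite ki andbT; apply/eqP => /hyperplanes_above_inj ki'.
  by have := HX k; rewrite ki' HkX.
have HZ i j : lev i = lev j -> (H i <= Order.join (X j) (H j))%O.
  move=> ij; apply/negPn/negP => /(maxX _ _ (DZ j)); rewrite (levX _ _ ij) => le_Z.
  by have := HX j; rewrite (le_trans _ le_Z) // leUr.
exists lev; split=> [i j ij lij|i].
  pose Y := Order.join (H i) (H j).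
  have YZ : (Y <= Order.join (X i) (H i))%O by rewrite leUx leUr HZ.
  have chK : chain [set H i; Y].
    by move=> _ _ [->|->] [->|->]; rewrite ?lexx ?leUl; auto.
  have gen W : (D `|` [set H i; Y]) W ->
      generated_sublattice (D `|` [set H i; Y]) W by apply: sub_gen_smallest.
  have gY := gen Y (or_intror (or_intror erefl)).
  have gH := gen (H i) (or_intror (or_introl erefl)).
  (* Since [Y] is below the join of [X i] and [H i], distributivity writes [Y] as the join of
     [Y /\ X i] and [H i]. If no hyperplane were below both [Y] and [X i], this would give
     [Y = H i], hence [i = j]. *)
  have := distD _ chK Y (X i) (H i) gY (gen _ (or_introl (DX i))) gH.
  rewrite (meet_idPl YZ) (meet_idPr (leUl _ _ : H i <= Y)%O) => YE.
  have [/existsP[k /andP[kY kX]]|nk] := boolP [exists k, (H k <= Y)%O && (H k <= X i)%O].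
    by exists k; [rewrite lev_lt|move/flat_leP: kY].
  have YX0 : Order.meet Y (X i) = X0.
    apply: hyperplanes_above_inj; apply/setP => k.
    rewrite !mem_hyperplanes_above lexI (negPf (HX0 k)).
    by apply: contraNF nk => kYX; apply/existsP; exists k.
  move: YE; rewrite YX0 (join_idPr (X0le _)) => YE.
  have : (H j <= H i)%O by rewrite -YE leUr.
  by move=> /flat_leP/hyperplane_sub_inj; move/eqP: ij.
have [u [uX ui]] : exists u, val (X i) u /\ ~ hyperplane i u.
  apply: contrapT => Hu; move/negP: (HX i); apply; apply/flat_leP => u uX.
  by apply: contrapT => ui; apply: Hu; exists u.
exists u; split=> [k|j ji uj]; first by rewrite lev_lt => /flat_leP; apply.
(* On the flat [X i], vanishing on one hyperplane of the level forces vanishing on all of them,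
   because [H i] is below the join of [X i] and [H j]. *)
apply: ui; have /flat_leP := HZ _ _ (esym ji); apply.
by split=> //; rewrite (levX _ _ ji).
Qed.

End Levels.

(** * Independence of Heaviside monomials *)

Section Chambers.
Variables (R : realType) (l : nat) (A : arrangement R l) (F : fieldType).
Local Notation n := (nhyp A).

Lemma dot_continuous (v : 'rV[R]_l) : continuous (dot v).
Proof.
rewrite /dot; elim: (index_enum _) => [|j s IHs].
  under [X in continuous X]boolp.eq_fun do rewrite big_nil.
  exact: cst_continuous.
under [X in continuous X]boolp.eq_fun do rewrite big_cons.
have cj : continuous (fun y : 'rV[R]_l => v 0 j * y 0 j).
  move=> y; apply: (@continuousM R 'rV[R]_l (fun=> v 0 j) (fun y : 'rV[R]_l => y 0 j)).
    exact: cst_continuous.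
  exact: coord_continuous.
move=> y; exact: (continuousD (cj y) (IHs y)).
Qed.

Lemma chamber_ofP (y : 'rV[R]_l) : arr_complement A y ->
  connected_component (arr_complement A) y \in chambers A.
Proof. by move=> hy; rewrite inE; exists y. Qed.

Definition chamber_of (y : 'rV[R]_l) (hy : arr_complement A y) : chamber A :=
  SigSub (chamber_ofP hy).

Lemma chamber_exists (C : chamber A) : exists y (hy : arr_complement A y), C = chamber_of hy.
Proof.
have [y hy yC] := set_mem (valP C); exists y, hy.
by apply: val_inj; rewrite /= -yC.
Qed.

Lemma arr_complementP (y : 'rV[R]_l) :
  arr_complement A y <-> forall i : 'I_n, dot (normal i) y != 0.
Proof.
split=> [hy i|hy [i _ yi]]; last by move/eqP: (hy i); apply.
by apply/eqP => yi; apply: hy; exists i.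
Qed.

(** A chamber is connected and the linear form has no zero on it, so by the intermediate value
    property its sign is constant there. *)
Lemma heaviside_chamber_of i (y : 'rV[R]_l) (hy : arr_complement A y) :
  heaviside F i (chamber_of hy) = (0 < dot (normal i) y)%R%:R.
Proof.
rewrite /heaviside; set C := \val _.
have Cy : C y by apply: connected_component_refl.
case: asboolP => [/(_ _ Cy) /= -> //|nC].
case: ltP => // y0; exfalso; apply: nC => z Cz; rewrite /pos_halfspace /= ltNge; apply/negP => z0.
have /connected_intervalP itv : connected (dot (normal i) @` C).
  apply: connected_continuous_connected; first exact: component_connected.
  by apply: continuous_subspaceT; apply: dot_continuous.
have [|w Cw w0] := itv _ _ (imageP _ Cz) (imageP _ Cy) 0; first by rewrite z0 ltW.
have /arr_complementP/(_ i) := connected_component_sub Cw.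
by rewrite w0 eqxx.
Qed.

End Chambers.

(** Used to choose a step shorter than the distance between a crossing and all other crossings on a
    line. *)
Lemma ex_pos_lower_bound (R : realFieldType) (I : finType) (g : I -> R) :
  exists2 eps, 0 < eps & forall i, 0 < g i -> eps < g i.
Proof.
suff [eps eps0 H] : exists2 eps, 0 < eps & forall i, i \in enum I -> 0 < g i -> eps < g i.
  by exists eps => // i; apply: H; rewrite mem_enum.
elim: (enum I) => [|i s [eps eps0 H]]; first by exists 1.
have [gi|gi] := ltP 0 (g i); last first.
  exists eps => // j; rewrite inE => /orP[/eqP->|/H//].
  by rewrite ltNge gi.
exists (Num.min eps (g i / 2)); first by rewrite lt_min eps0 divr_gt0.
move=> j; rewrite inE => /orP[/eqP-> _|/H jH /jH]; rewrite gt_min.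
  by apply/orP; right; lra.
by move=> ->.
Qed.

(** * Sets with at most one element per level, which index the monomial basis *)

Section Transversals.
Variables (n : nat) (lev : 'I_n -> nat).
Implicit Types (T : {set 'I_n}) (i j k : 'I_n) (m : nat).

Definition level_transversal T : bool :=
  [forall i in T, forall j in T, (lev i == lev j) ==> (i == j)].

Lemma level_transversalP T : reflect {in T &, injective lev} (level_transversal T).
Proof.
apply: (iffP forall_inP) => [H i j iT jT /eqP ij|H i iT].
  by have /forall_inP/(_ _ jT)/implyP/(_ ij)/eqP := H i iT.
by apply/forall_inP => j jT; apply/implyP => /eqP /H-> //.
Qed.

Definition transversal_below m T : bool := level_transversal T && [forall i in T, (lev i < m)%N].

Lemma transversal_belowP m T :
  reflect (level_transversal T /\ forall i, i \in T -> (lev i < m)%N) (transversal_below m T).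
Proof. by apply: (iffP andP) => -[tT /forall_inP]. Qed.

Lemma transversalU1 i T : level_transversal T -> (forall j, j \in T -> lev j != lev i) ->
  level_transversal (i |: T).
Proof.
move=> /level_transversalP tT Ti; apply/level_transversalP => j k.
rewrite !finset.in_setU1 => /orP[/eqP->|jT] /orP[/eqP->|kT] // jk.
- by have := Ti _ kT; rewrite jk eqxx.
- by have := Ti _ jT; rewrite jk eqxx.
- exact: tT.
Qed.

Lemma transversal_sub T T' : T \subset T' -> level_transversal T' -> level_transversal T.
Proof.
move=> /fintype.subsetP sT /level_transversalP tT.
by apply/level_transversalP => i j /sT iT /sT; apply: tT.
Qed.

Lemma transversal_belowD1 m i T : lev i = m -> i \in T ->
  transversal_below m.+1 T -> transversal_below m (T :\ i).
Proof.
move=> im iT /transversal_belowP[tT Tm]; apply/transversal_belowP; split.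
  by apply: transversal_sub tT; apply: subD1set.
move=> j; rewrite finset.in_setD1 => /andP[ji jT]; have := Tm _ jT.
rewrite ltnS leq_eqVlt => /orP[/eqP jm|//]; move/level_transversalP: tT => /(_ j i jT iT).
by rewrite jm im => /(_ erefl) ji'; rewrite ji' eqxx in ji.
Qed.

Lemma transversal_belowU1 m i T : lev i = m -> transversal_below m T ->
  transversal_below m.+1 (i |: T).
Proof.
move=> im /transversal_belowP[tT Tm]; apply/transversal_belowP; split.
  by apply: transversalU1 => // j /Tm jm; rewrite im ltn_eqF.
by move=> j; rewrite finset.in_setU1 => /orP[/eqP->|/Tm/ltnW//]; rewrite im.
Qed.

End Transversals.

(** * Independence by jumps across hyperplanes *)

Section Independence.
Variables (R : realType) (l : nat) (A : arrangement R l) (F : fieldType).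
Local Notation n := (nhyp A).
Variable lev : 'I_n -> nat.

Hypothesis lev_pair : forall i j, i != j -> lev i = lev j ->
  exists2 k, (lev k < lev i)%N & hyperplane i `&` hyperplane j `<=` hyperplane k.
Hypothesis lev_line : forall i, exists u,
  (forall k, (lev k < lev i)%N -> hyperplane k u) /\
  forall j, lev j = lev i -> ~ hyperplane j u.

Let v (i : 'I_n) : 'rV[R]_l := normal i.
Let x (i : 'I_n) (y : 'rV[R]_l) : F := (0 < dot (v i) y)%R%:R.
Let generic m y := forall k, (lev k < m)%N -> dot (v k) y != 0.

(* Crossing [hyperplane i] along a line parallel to the flat of the lower
   levels: the other hyperplanes of the same level are met elsewhere, because
   two of them only meet inside a hyperplane of lower level. *)
Lemma crossing m i y : lev i = m -> generic m y -> exists y1 y2,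
  [/\ generic m.+1 y1, generic m.+1 y2,
      forall k, (lev k < m)%N -> x k y1 = x k y /\ x k y2 = x k y,
      forall k, (lev k <= m)%N -> k != i -> x k y1 = x k y2 &
      x i y1 - x i y2 = 1].
Proof.
move=> im gy; have [u [uk uj]] := lev_line i; rewrite im in uk uj.
have vu j : lev j = m -> dot (v j) u != 0 by move=> /uj /eqP.
(* The parameter at which the line [y + s *: u] meets hyperplane [j]. *)
pose t j := - dot (v j) y / dot (v j) u.
have vt j s : lev j = m -> dot (v j) (y + s *: u) = dot (v j) u * (s - t j).
  by move=> /vu juN0; rewrite dotDr dotZr /t; field.
(* A common crossing point would lie on a hyperplane [k] of lower level; but the form of [k] is
   constant along the line and nonzero at [y]. *)
have tN j : lev j = m -> j != i -> t j != t i.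
  move=> jm ji; apply/eqP => tji.
  have [k] := lev_pair ji (etrans jm (esym im)); rewrite jm => km /(_ (y + t i *: u)).
  have vj0 : dot (v j) (y + t i *: u) = 0 by rewrite vt // tji subrr mulr0.
  have vi0 : dot (v i) (y + t i *: u) = 0 by rewrite vt // subrr mulr0.
  move=> /(_ (conj vj0 vi0)); rewrite /hyperplane /hyp /= dotDr dotZr.
  by rewrite (uk _ km) mulr0 addr0; apply/eqP; apply: gy.
(* Moving from [t i - eps] to [t i + eps] crosses only hyperplane [i] at this level, and lower
   levels are not crossed at all. *)
have [eps eps0 epsP] := ex_pos_lower_bound (fun j => `|t j - t i|).
have vlow k s : (lev k < m)%N -> dot (v k) (y + s *: u) = dot (v k) y.
  by move=> km; rewrite dotDr dotZr (uk _ km) mulr0 addr0.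
have sgn j : lev j = m -> j != i ->
    [/\ t i + eps - t j != 0, t i - eps - t j != 0 &
        (0 < t i + eps - t j) = (0 < t i - eps - t j)].
  move=> jm ji; have := epsP j; rewrite normr_gt0 subr_eq0 tN // => /(_ isT).
  have [tij|tij] := leP (t i) (t j).
    rewrite ger0_norm ?subr_ge0 // => lt_eps; split; [apply/eqP; lra|apply/eqP; lra|].
    by apply/idP/idP => ?; lra.
  rewrite ltr0_norm ?subr_lt0 // => lt_eps; split; [apply/eqP; lra|apply/eqP; lra|].
  by apply/idP/idP => ?; lra.
have xE j s : lev j = m -> s - t j != 0 ->
    x j (y + s *: u) = ((0 < dot (v j) u) == (0 < s - t j))%R%:R.
  move=> jm stN0; rewrite /x vt //; congr (_%:R); move: (vu _ jm) stN0.
  case: (ltgtP 0 (dot (v j) u)) => [u0|u0|<-]; rewrite ?eqxx // => _ st.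
    by rewrite pmulr_rgt0.
  by rewrite nmulr_rgt0 //; case: (ltgtP 0 (s - t j)) st => // <-; rewrite eqxx.
have gen s : s = t i + eps \/ s = t i - eps -> generic m.+1 (y + s *: u).
  move=> sE k; rewrite ltnS leq_eqVlt => /orP[/eqP km|km]; last by rewrite vlow // gy.
  rewrite vt // mulf_neq0 ?vu //; have [->|ki] := eqVneq k i.
    by case: sE => ->; apply/eqP; lra.
  by have [? ? _] := sgn _ km ki; case: sE => ->.
have xlow k s : (lev k < m)%N -> x k (y + s *: u) = x k y.
  by move=> km; rewrite /x vlow.
have xsame k : (lev k <= m)%N -> k != i ->
    x k (y + (t i + eps) *: u) = x k (y + (t i - eps) *: u).
  rewrite leq_eqVlt => /orP[/eqP km ki|km _]; last by rewrite !xlow.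
  by have [? ? e] := sgn _ km ki; rewrite !xE // e.
have xi : x i (y + (t i + eps) *: u) = (0 < dot (v i) u)%R%:R.
  have E : t i + eps - t i = eps by rewrite addrAC subrr add0r.
  by rewrite xE ?E ?eps0 ?(gt_eqF eps0) //; case: (0 < _).
have xi' : x i (y + (t i - eps) *: u) = (~~ (0 < dot (v i) u)%R)%:R.
  have E : t i - eps - t i = - eps by rewrite addrAC subrr add0r.
  rewrite xE ?E ?oppr_eq0 ?(gt_eqF eps0) // oppr_gt0.
  by rewrite [(eps < 0)%R]ltNge (ltW eps0); case: (0 < _).
(* The direction of [u] decides which end is on the positive side; [y1] is that end, so the jump is
   [+1]. *)
have [ui|ui] := boolP (0 < dot (v i) u).
  exists (y + (t i + eps) *: u), (y + (t i - eps) *: u); split.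
  - by apply: gen; left.
  - by apply: gen; right.
  - by move=> k km; rewrite !xlow.
  - exact: xsame.
  - by rewrite xi xi' ui subr0.
exists (y + (t i - eps) *: u), (y + (t i + eps) *: u); split.
- by apply: gen; right.
- by apply: gen; left.
- by move=> k km; rewrite !xlow.
- by move=> k km ki; rewrite xsame.
- by rewrite xi xi' (negPf ui) subr0.
Qed.

Local Notation tb := (transversal_below lev).

(** Induction on the levels. Subtracting the relation at the two sides of a hyperplane [i] of level
    [m] cancels the monomials without [i] and leaves a relation in lower levels between the
    coefficients of the sets [i |: T]. Once these vanish, only lower levels remain. *)
Lemma points_independent m (c : {set 'I_n} -> F) :
  (forall y, generic m y -> \sum_(T | tb m T) c T * \prod_(i in T) x i y = 0) ->
  forall T, tb m T -> c T = 0.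
Proof.
elim: m c => [|m IHm] c c0 T.
  have tb0 (S : {set 'I_n}) : tb 0 S = (S == finset.set0).
    apply/transversal_belowP/eqP => [[_ S0]|->].
      by apply/eqP; rewrite -finset.subset0; apply/fintype.subsetP => i /S0.
    by split=> [|i]; [apply/level_transversalP => i j|]; rewrite finset.in_set0.
  have := c0 0 (fun k => ltac:(by [])).
  by rewrite tb0 (big_pred1 _ tb0) big_set0 mulr1 => + /eqP->.
have top i : lev i = m -> forall T, tb m T -> c (i |: T) = 0.
  move=> im; apply: (IHm (fun T => c (i |: T))) => y gy.
  have [y1 [y2 [gy1 gy2 xlow xsame xi]]] := crossing im gy.
  pose f y := \sum_(T | tb m.+1 T) c T * \prod_(i in T) x i y.
  have : f y1 - f y2 == 0 by rewrite /f c0 // c0 // subrr.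
  rewrite /f -sumrB.
  rewrite (bigID (fun T : {set 'I_n} => i \in T)) /= addrC big1 ?add0r; last first.
    move=> S /andP[/transversal_belowP[_ Sm] iS]; apply/eqP; rewrite subr_eq0; apply/eqP.
    congr (_ * _); apply: eq_bigr => k kS; apply: xsame; first exact: Sm.
    by apply: contraNneq iS => <-.
  rewrite (reindex_onto (fun S => i |: S) (fun S => S :\ i)) /=; last first.
    by move=> S /andP[_ iS]; rewrite finset.setD1K.
  move=> /eqP H; rewrite -[RHS]H; apply: eq_big => [S|S tS].
    apply/idP/idP => [tS|/andP[/andP[tS iS] /eqP <-]].
      rewrite transversal_belowU1 // finset.setU11 /=; apply/eqP; apply: finset.setU1K.
      by apply/negP => iS; have /transversal_belowP[_ /(_ _ iS)] := tS; rewrite im ltnn.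
    exact: transversal_belowD1.
  have iS : i \notin S.
    by apply/negP => iS; have /transversal_belowP[_ /(_ _ iS)] := tS; rewrite im ltnn.
  rewrite !big_setU1 //= -mulrBr; congr (_ * _).
  rewrite [X in _ * X - _](eq_bigr (x^~ y)) => [|k kS]; last first.
    by have /transversal_belowP[_ /(_ _ kS)/xlow[->]] := tS.
  rewrite [X in _ - _ * X](eq_bigr (x^~ y)) => [|k kS]; last first.
    by have /transversal_belowP[_ /(_ _ kS)/xlow[_ ->]] := tS.
  by rewrite -mulrBl xi mul1r.
have {}top i (S : {set 'I_n}) : lev i = m -> i \in S -> tb m.+1 S -> c S = 0.
  by move=> im iS tS; rewrite -(finset.setD1K iS) top //; apply: transversal_belowD1.
have topN (S : {set 'I_n}) : tb m.+1 S -> ~~ tb m S -> c S = 0.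
  move=> tS; have [tS' Sm] := transversal_belowP _ _ _ tS.
  rewrite /transversal_below tS' /= => /forall_inPn[i iS]; rewrite -leqNgt => im.
  by apply: (top i) => //; apply/eqP; rewrite eqn_leq im -ltnS Sm.
move=> tT; have [tT'|] := boolP (tb m T); last exact: topN.
apply: (IHm c) tT' => y gy.
(* A point generic for the lower levels is moved off the hyperplanes of level [m] without changing
   its lower signs. *)
have [y1 gy1 xy1] : exists2 y1, generic m.+1 y1 & forall k, (lev k < m)%N -> x k y1 = x k y.
  have [/existsP[i /eqP im]|ni] := boolP [exists i, lev i == m].
    have [y1 [y2 [gy1 _ xlow _ _]]] := crossing im gy.
    by exists y1 => // k /xlow[].
  exists y => // k; rewrite ltnS leq_eqVlt => /orP[km|]; last exact: gy.
  by case/negP: ni; apply/existsP; exists k.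
have := c0 y1 gy1; rewrite (bigID (tb m)) /= [X in _ + X]big1 ?addr0; last first.
  by move=> S /andP[tS nS]; rewrite topN // mul0r.
move=> c0'; rewrite -[RHS]c0'.
apply: eq_big => [S|S tS].
  apply/idP/andP => [tS|[]//]; split=> //.
  have /transversal_belowP[tS' Sm] := tS; apply/transversal_belowP; split=> // i /Sm.
  exact: ltnW.
congr (_ * _); apply: eq_bigr => k kS.
by have /transversal_belowP[_ /(_ _ kS)/xy1] := tS.
Qed.

(** With [m] beyond every level, generic points are those of the complement; evaluating at their
    chambers gives the pointwise relations. *)
Lemma heaviside_independent (c : {set 'I_n} -> F) :
  \sum_(T | level_transversal lev T) c T *: (\prod_(i in T) heaviside F i) = 0 ->
  forall T, level_transversal lev T -> c T = 0.
Proof.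
move=> c0 T tT; pose m := (\max_i lev i).+1.
have tbm (S : {set 'I_n}) : tb m S = level_transversal lev S.
  by rewrite /transversal_below andb_idr // => _; apply/forall_inP => i _; rewrite ltnS leq_bigmax.
apply: (@points_independent m c); last by rewrite tbm.
move=> y gy; have hy : arr_complement A y.
  by apply/arr_complementP => i; apply: gy; rewrite ltnS leq_bigmax.
pose ev := fun f : VG A F => f (chamber_of hy).
have evD : {morph ev : f g / f + g} by [].
have evM : {morph ev : f g / f * g} by [].
have := congr1 ev c0; rewrite (big_morph ev evD (erefl : ev 0 = 0)) => c0'.
rewrite -[RHS]c0'; apply: eq_big => [S|S _]; first exact: tbm.
transitivity (c S * ev (\prod_(i in S) heaviside F i)) => //.
rewrite (big_morph ev evM (erefl : ev 1 = 1)); congr (_ * _).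
by apply: eq_bigr => i _; rewrite /ev heaviside_chamber_of.
Qed.

End Independence.

(** * Straightening and colon ideals *)

Section Straightening.
Variables (F : fieldType) (V : comAlgType F) (n : nat) (e : 'I_n -> V) (lev : 'I_n -> nat).
Hypothesis e_sq : forall i, e i * e i = 0.
Hypothesis e_pair : forall i j, i != j -> lev i = lev j -> exists k (a b : F),
  (lev k < lev i)%N /\ e i * e j = a *: (e k * e i) + b *: (e k * e j).
Implicit Types (T : {set 'I_n}) (i j k : 'I_n) (w : seq 'I_n) (P Q : pred 'I_n).

Local Notation eT T := (\prod_(i in T) e i).

(** The rewriting by [e_pair] introduces a factor of lower level; under this condition a monomial
    with a factor in [P] keeps one. *)
Definition lower_closed P := forall i k, P i -> (lev k < lev i)%N -> P k.

Lemma ex_repeated_level w : ~~ uniq (map lev w) ->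
  exists i j w', perm_eq w [:: i, j & w'] /\ lev i = lev j.
Proof.
elim: w => [//|a w IHw] /=; rewrite negb_and negbK => /orP[/mapP[b bw ab]|/IHw].
  by exists a, b, (rem b w); split=> //; rewrite perm_cons perm_to_rem.
move=> [i [j [w' [pw ij]]]]; exists i, j, (a :: w'); split=> //.
have -> : [:: i, j, a & w'] = [:: i; j] ++ [:: a] ++ w' by [].
by rewrite perm_sym perm_catCA /= perm_cons perm_sym.
Qed.

(* The rewriting [e_pair] lowers the sum of the levels. *)
Lemma straightening P w : lower_closed P ->
  span [set u | exists T, [/\ level_transversal lev T, #|T| = size w,
                  has P w -> exists2 i, i \in T & P i & u = eT T]]
    (\prod_(i <- w) e i).
Proof.
move=> downP; have [N] := ubnP (\sum_(i <- w) lev i)%N.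
elim: N w => // N IHN w wN.
have [uw|/ex_repeated_level[i [j [w' [pw ij]]]]] := boolP (uniq (map lev w)).
  have uw' := map_uniq uw; apply: mem_span; exists (finset.finset (mem w)); split.
  - apply/level_transversalP => i j; rewrite !finset.in_set /= => iw jw lij.
    rewrite -(nth_index i iw) -(nth_index i jw); congr nth.
    apply/eqP; rewrite -(nth_uniq 0%N _ _ uw) ?size_map ?index_mem //.
    by rewrite !(nth_map i) ?index_mem // !nth_index // lij.
  - by rewrite cardsE; apply/card_uniqP.
  - by move=> /hasP[i iw Pi]; exists i => //; rewrite finset.in_set.
  - rewrite big_uniq //=; apply: eq_bigl => i; by rewrite finset.in_set.
rewrite (perm_big _ pw) /= !big_cons mulrA.
have [<-|nij] := eqVneq i j; first by rewrite e_sq mul0r; apply: span0.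
have [k [a [b [ki ->]]]] := e_pair nij ij.
move: wN; rewrite (perm_big _ pw) /= !big_cons => wN.
(* Both terms of [e_pair] have this shape: one of two factors of equal level is replaced by [k], so
   the sum of the levels drops. *)
have red h : lev h = lev i ->
    span [set u | exists T, [/\ level_transversal lev T, #|T| = size w,
                  has P w -> exists2 i, i \in T & P i & u = eT T]]
      (e k * e h * \prod_(l <- w') e l).
  move=> hi; have := IHN [:: k, h & w']; rewrite !big_cons mulrA => IH.
  apply: (span_mono _ (IH _)) => [u [T [tT sT PT ->]]|]; last first.
    by move: wN; rewrite ?big_cons; lia.
  exists T; split=> //; first by rewrite sT (perm_size pw).
  rewrite (perm_has _ pw) /= => PW; apply: PT => /=; case/or3P: PW => [Pi|Pj|->].
  - by rewrite (downP _ _ Pi ki).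
  - by rewrite (downP _ _ Pj) // -ij.
  - by rewrite !orbT.
rewrite mulrDl -!scalerAl; apply: spanD; apply: spanZ; apply: red => //.
Qed.

Lemma span_eT (Q : pred {set 'I_n}) u : span [set u | exists2 T, Q T & u = eT T] u ->
  exists c : {set 'I_n} -> F, u = \sum_(T | Q T) c T *: eT T.
Proof.
move: u; apply: span_ind => [|a _ _ [T QT ->] [c ->]].
  by exists (fun=> 0); rewrite big1 // => T _; rewrite scale0r.
exists (fun S => (if S == T then a else 0) + c S).
under [RHS]eq_bigr do rewrite scalerDl; rewrite big_split /=; congr (_ + _).
rewrite (bigD1 T) //= eqxx [X in _ + X]big1 ?addr0 // => S /andP[_ /negPf->].
by rewrite scale0r.
Qed.

Definition gen_ideal P (a : V) : Prop := exists c : 'I_n -> V, a = \sum_(i | P i) c i * e i.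

Lemma gen_ideal0 P : gen_ideal P 0.
Proof. by exists (fun=> 0); rewrite big1 // => i _; rewrite mul0r. Qed.

Lemma gen_idealD P a b : gen_ideal P a -> gen_ideal P b -> gen_ideal P (a + b).
Proof.
move=> [c ->] [d ->]; exists (fun i => c i + d i); rewrite -big_split.
by apply: eq_bigr => i _; rewrite mulrDl.
Qed.

Lemma gen_idealMl P a b : gen_ideal P b -> gen_ideal P (a * b).
Proof.
move=> [c ->]; exists (fun i => a * c i); rewrite mulr_sumr.
by apply: eq_bigr => i _; rewrite mulrA.
Qed.

Lemma gen_idealZ P (a : F) b : gen_ideal P b -> gen_ideal P (a *: b).
Proof. by rewrite -[b in _ *: b]mul1r scalerAl; apply: gen_idealMl. Qed.

Lemma gen_ideal_sum P (I : Type) (r : seq I) (Q : pred I) (f : I -> V) :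
  (forall s, Q s -> gen_ideal P (f s)) -> gen_ideal P (\sum_(s <- r | Q s) f s).
Proof.
by move=> hf; elim/big_ind: _ => //; [apply: gen_ideal0|apply: gen_idealD].
Qed.

Lemma gen_ideal_gen P i : P i -> gen_ideal P (e i).
Proof.
move=> Pi; exists (fun k => (k == i)%:R); rewrite (bigD1 i) //= eqxx mul1r.
by rewrite big1 ?addr0 // => k /andP[_ /negPf->]; rewrite mul0r.
Qed.

Definition meets P T := [exists i in T, P i].

Lemma gen_ideal_eT P T : meets P T -> gen_ideal P (eT T).
Proof.
move=> /exists_inP[i iT Pi]; rewrite (bigD1 i) //= mulrC.
by apply: gen_idealMl; apply: gen_ideal_gen.
Qed.

Hypothesis e_span : forall a : V, span [set u | exists w, u = \prod_(i <- w) e i] a.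
Hypothesis e_indep : forall c : {set 'I_n} -> F,
  \sum_(T | level_transversal lev T) c T *: eT T = 0 -> forall T, level_transversal lev T -> c T = 0.

Lemma eT_span a : exists c : {set 'I_n} -> F, a = \sum_(T | level_transversal lev T) c T *: eT T.
Proof.
apply: span_eT; move: a (e_span a); apply: span_ind => [|a _ u [w ->] hu]; first exact: span0.
apply: spanD => //; apply: spanZ.
have := @straightening pred0 w (fun i k => ltac:(by [])).
by apply: span_mono => _ [T [tT _ _ ->]]; exists T.
Qed.

(** Straightening a multiple of [e i] with [P i] keeps a factor in [P], so the ideal is spanned by
    basis monomials, as a monomial ideal would be. *)
Lemma gen_ideal_span P a : lower_closed P -> gen_ideal P a ->
  exists c : {set 'I_n} -> F, a = \sum_(T | level_transversal lev T && meets P T) c T *: eT T.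
Proof.
move=> downP [c ->]; apply: span_eT; elim/big_ind: _ => [||i Pi].
- exact: span0.
- exact: spanD.
move: (c i) (e_span (c i)); apply: span_ind => [|b _ u [w ->] hu].
  by rewrite /mkset mul0r; apply: span0.
rewrite /mkset mulrDl -scalerAl; apply: spanD => //; apply: spanZ.
have := @straightening P (i :: w) downP; rewrite big_cons mulrC.
apply: span_mono => _ [T [tT _ PT ->]]; exists T => //; rewrite tT /=.
have [|k kT Pk] := PT; first by rewrite /= Pi.
by apply/exists_inP; exists k.
Qed.

(** Generators of level at most that of [j] are in the colon by [e_sq] and [e_pair]. Conversely,
    multiplying by [e j] sends the basis monomials free of such generators to distinct basis
    monomials outside the ideal, so independence removes them from [a]. *)
Lemma colon_gen_ideal P j a : lower_closed P -> ~~ P j ->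
  (forall i, (lev i < lev j)%N -> P i) ->
  gen_ideal P (a * e j) <-> gen_ideal (fun i => (lev i <= lev j)%N) a.
Proof.
move=> downP Pj Pbelow; set Q := fun i => _.
have Qcolon b : gen_ideal Q b -> gen_ideal P (b * e j).
  move=> [c ->]; rewrite mulr_suml; apply: gen_ideal_sum => i.
  rewrite -mulrA /Q leq_eqVlt => /orP[/eqP ij|ij]; apply: gen_idealMl.
    have [->|nij] := eqVneq i j; first by rewrite e_sq; apply: gen_ideal0.
    have [k [x [y [ki ->]]]] := e_pair nij ij.
    have Pk : gen_ideal P (e k) by apply: gen_ideal_gen; apply: Pbelow; rewrite -ij.
    by apply: gen_idealD; apply: gen_idealZ; rewrite mulrC; apply: gen_idealMl.
  by rewrite mulrC; apply: gen_idealMl; apply: gen_ideal_gen; apply: Pbelow.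
split=> [Paj|]; last exact: Qcolon.
have [c aE] := eT_span a.
move: aE; rewrite (bigID (meets Q)) /=.
set a1 := (X in X + _); set a2 := (X in _ + X) => aE.
have Qa1 : gen_ideal Q a1.
  by apply: gen_ideal_sum => T /andP[_ QT]; apply: gen_idealZ; apply: gen_ideal_eT.
have Pa2 : gen_ideal P (a2 * e j).
  have -> : a2 * e j = a * e j + (- 1) * (a1 * e j) by rewrite aE mulrDl mulN1r addrAC subrr add0r.
  by apply: gen_idealD => //; apply: gen_idealMl; apply: Qcolon.
have [d dE] := gen_ideal_span downP Pa2.
have jQ T : ~~ meets Q T -> j \notin T.
  by apply: contra => jT; apply/exists_inP; exists j => //; apply: leqnn.
have tU T : level_transversal lev T -> ~~ meets Q T -> level_transversal lev (j |: T).
  move=> tT QT; apply: transversalU1 => // i iT; apply: contra QT => /eqP ij.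
  by apply/exists_inP; exists i; rewrite /Q ?ij.
(* Difference of the coefficients of the two expansions of [a2 * e j]: the product itself, supported
   on sets containing [j], and the one given by membership in the ideal. *)
pose cd (S : {set 'I_n}) := (if (j \in S) && ~~ meets Q (S :\ j) then c (S :\ j) else 0) -
             (if meets P S then d S else 0).
have cd0 : \sum_(S | level_transversal lev S) cd S *: eT S = 0.
  under eq_bigr do rewrite /cd scalerBl.
  rewrite sumrB; apply/eqP; rewrite subr_eq0; apply/eqP.
  transitivity (a2 * e j); last first.
    rewrite dE big_mkcondr /=; apply: eq_bigr => S _.
    by case: ifP => _; rewrite ?scale0r.
  rewrite (eq_bigr (fun S : {set 'I_n} =>
      if (j \in S) && ~~ meets Q (S :\ j) then c (S :\ j) *: eT S else 0)).
    rewrite -big_mkcondr /= (reindex_onto (fun S => j |: S) (fun S => S :\ j)) /=; last first.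
      by move=> S /andP[_ /andP[jS _]]; rewrite finset.setD1K.
    rewrite /a2 mulr_suml; apply: eq_big => [S|S /andP[/andP[_ /andP[_ nQ]] /eqP SE]].
      rewrite finset.setU11 /=; apply/idP/idP => [/andP[/andP[tS nQ] /eqP SE]|/andP[tS nQ]].
        rewrite SE in nQ; rewrite nQ andbT; apply: transversal_sub tS.
        exact: finset.subsetUr.
      by rewrite finset.setU1K ?jQ // tU // nQ eqxx.
    rewrite SE in nQ *; by rewrite big_setU1 ?jQ //= -scalerAl mulrC.
  by move=> S _; case: ifP => _; rewrite ?scale0r.
(* The set [j |: T] does not meet [P]: an element of [T] in [P] has level above that of [j], and
   lower closure would put [j] in [P]. So only [c T] is left in [cd]. *)
have c0 T : level_transversal lev T -> ~~ meets Q T -> c T = 0.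
  move=> tT QT; have := e_indep cd0 (tU _ tT QT).
  rewrite /cd finset.setU11 finset.setU1K ?jQ //= QT [meets P _]negbTE ?subr0 //.
  apply/exists_inPn => i; rewrite finset.in_setU1 => /orP[/eqP->//|iT].
  apply: contra Pj => Pi; apply: (downP i) => //; rewrite ltnNge.
  by apply: contra QT => ij; apply/exists_inP; exists i.
have -> : a = a1; last exact: Qa1.
by rewrite aE /a2 big1 ?addr0 // => T /andP[tT QT]; rewrite c0 // scale0r.
Qed.

End Straightening.

(** * The associated graded ring *)

Section AssociatedGraded.
Variables (F : fieldType) (V : comAlgType F) (n : nat) (x : 'I_n -> V).
Implicit Types (c b : V) (d : nat).

(* The class in [F_d / F_(d-1)] of an element of [F_d]; junk outside [F_d]. *)
Definition gr_symbol d c : gr x := gr_class (insubd (0 : rees x) (c *: 'X^d)).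

Lemma gr_symbol_val d c : filtration x d c ->
  val (insubd (0 : rees x) (c *: 'X^d)) = c *: 'X^d.
Proof. by move=> hc; apply: insubdK; apply: rees_monomP. Qed.

Lemma gr_symbol_class d c (p : rees x) : val p = c *: 'X^d -> gr_class p = gr_symbol d c.
Proof.
move=> pE; congr (gr_class _); apply: val_inj; rewrite pE gr_symbol_val //.
by have := rees_coef p d; rewrite pE coefZ coefXn eqxx mulr1.
Qed.

Lemma gr_symbolZD d (a : F) c b : filtration x d c -> filtration x d b ->
  gr_symbol d (a *: c + b) = a *: gr_symbol d c + gr_symbol d b.
Proof.
move=> hc hb; rewrite {2 3}/gr_symbol gr_class_scale -rmorphD; apply/esym/gr_symbol_class.
rewrite rmorphD rmorphM /= !gr_symbol_val // mul_polyC scalerA -scalerDl.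
by rewrite -scalerAl mul1r.
Qed.

Lemma gr_symbolM d d' c b : filtration x d c -> filtration x d' b ->
  gr_symbol d c * gr_symbol d' b = gr_symbol (d + d') (c * b).
Proof.
move=> hc hb; rewrite /gr_symbol -rmorphM; apply: gr_symbol_class.
by rewrite rmorphM /= !gr_symbol_val // exprD -scalerAl -scalerAr scalerA.
Qed.

Lemma gr_symbol0 d : gr_symbol d 0 = 0.
Proof.
rewrite -(rmorph0 (@gr_class F V n x)); apply/esym/gr_symbol_class.
by rewrite scale0r raddf0.
Qed.

Lemma gr_symbol_eq0 d c : filtration x d c ->
  gr_symbol d c = 0 <-> filtration_pred x d c.
Proof.
move=> hc; split=> [/gr_class_eq0/(_ d)|hc'].
  by rewrite gr_symbol_val // coefZ coefXn eqxx mulr1.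
rewrite -(rmorph0 (@gr_class F V n x)); apply: gr_class_eq => d'.
rewrite raddf0 coef0 subr0 gr_symbol_val // coefZ coefXn.
by case: eqP => [->|_]; rewrite ?mulr1 ?mulr0 //; apply: filtration_pred0.
Qed.

Lemma filtration_word w d : (size w <= d)%N -> filtration x d (\prod_(i <- w) x i).
Proof. by move=> wd; apply: mem_span; exists w. Qed.

Lemma filtration_gen i : filtration x 1 (x i).
Proof. by have := @filtration_word [:: i] 1 isT; rewrite big_seq1. Qed.

Lemma gr_genE i : gr_gen x i = gr_symbol 1 (x i).
Proof. exact: gr_symbol_class. Qed.

Lemma prod_gr_gen w : \prod_(i <- w) gr_gen x i = gr_symbol (size w) (\prod_(i <- w) x i).
Proof.
elim: w => [|i w IHw].
  rewrite !big_nil -(rmorph1 (@gr_class F V n x)); apply: gr_symbol_class.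
  by rewrite expr0 scale1r rmorph1.
rewrite !big_cons IHw gr_genE gr_symbolM //; first exact: filtration_gen.
exact: filtration_word.
Qed.

Lemma filtration_set (T : {set 'I_n}) : filtration x #|T| (\prod_(i in T) x i).
Proof. by rewrite -big_enum /= cardE; apply: filtration_word. Qed.

Lemma prod_gr_gen_set (T : {set 'I_n}) :
  \prod_(i in T) gr_gen x i = gr_symbol #|T| (\prod_(i in T) x i).
Proof. by rewrite -!big_enum /= prod_gr_gen -cardE. Qed.

Lemma gr_symbol_sum d (I : Type) (r : seq I) (Q : pred I) (a : I -> F) (f : I -> V) :
  (forall i, Q i -> filtration x d (f i)) ->
  filtration x d (\sum_(i <- r | Q i) a i *: f i) /\
  gr_symbol d (\sum_(i <- r | Q i) a i *: f i) = \sum_(i <- r | Q i) a i *: gr_symbol d (f i).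
Proof.
move=> hf; elim: r => [|i r [IH1 IH2]].
  by rewrite !big_nil gr_symbol0; split=> //; apply: span0.
rewrite !big_cons; case: ifP => // Qi; split; last by rewrite gr_symbolZD ?IH2 //; apply: hf.
by apply: spanD => //; apply: spanZ; apply: hf.
Qed.

(** The field [sga_hom_gen] hides its generators behind an existential; here they are the
    [gr_gen x i]. *)
Lemma gr_hom_span d : gr_hom d `<=` span (monomials (gr_gen x) d).
Proof.
move=> _ [c [p [pE ->]]]; rewrite (gr_symbol_class pE).
have dc : filtration x d c.
  by have := rees_coef p d; rewrite pE coefZ coefXn eqxx mulr1.
suff [] : filtration x d c /\ span (monomials (gr_gen x) d) (gr_symbol d c) by [].
move: c dc {pE}; apply: span_ind => [|a _ c [w [wd ->]] [hc IH]].
  by split; [exact: span0|rewrite gr_symbol0; apply: span0].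
have hw := filtration_word wd.
split; first by apply: spanD => //; apply: spanZ.
rewrite gr_symbolZD //; apply: spanD => //; apply: spanZ.
case: (ltnP (size w) d) => [lt_wd|ge_wd].
  rewrite (_ : gr_symbol _ _ = 0); first exact: span0.
  by apply/gr_symbol_eq0 => //; case: d lt_wd {wd hc IH hw} => // d wd; apply: filtration_word.
have {ge_wd} wd' : size w = d by apply/eqP; rewrite eqn_leq wd.
by apply: mem_span; exists w; rewrite prod_gr_gen wd'.
Qed.

Variable lev : 'I_n -> nat.
(** These relations hold modulo filtration degree 1; products of two generators sit in degree 2, so
    the error terms vanish in the graded ring. *)
Hypothesis x_sq : forall i, filtration x 1 (x i * x i).
Hypothesis x_pair : forall i j, i != j -> lev i = lev j -> exists k (a b : F),
  (lev k < lev i)%N /\ filtration x 1 (x i * x j - (a *: (x k * x i) + b *: (x k * x j))).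
Hypothesis x_indep : forall c : {set 'I_n} -> F,
  \sum_(T | level_transversal lev T) c T *: (\prod_(i in T) x i) = 0 ->
  forall T, level_transversal lev T -> c T = 0.

Let e : 'I_n -> gr_sga x := gr_gen x.

Lemma gr_gen_sq i : e i * e i = 0.
Proof.
rewrite /e gr_genE gr_symbolM; try exact: filtration_gen.
apply/gr_symbol_eq0; last exact: x_sq.
by apply: filtrationM; apply: filtration_gen.
Qed.

Lemma gr_gen_pair i j : i != j -> lev i = lev j -> exists k (a b : F),
  (lev k < lev i)%N /\ e i * e j = a *: (e k * e i) + b *: (e k * e j).
Proof.
move=> nij ij; have [k [a [b [ki H]]]] := x_pair nij ij; exists k, a, b; split=> //.
have f2 s t : filtration x 2 (x s * x t).
  by apply: (@filtrationM _ _ _ _ 1 1); apply: filtration_gen.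
rewrite /e !gr_genE !gr_symbolM; try exact: filtration_gen.
have fab : filtration x 2 (a *: (x k * x i) + b *: (x k * x j)).
  by apply: spanD; apply: spanZ; apply: f2.
have E0 c : b *: gr_symbol 2 c = b *: gr_symbol 2 c + gr_symbol 2 0 by rewrite gr_symbol0 addr0.
rewrite (E0 (x k * x j)) -gr_symbolZD ?addr0 //; last exact: span0.
rewrite -gr_symbolZD //; last by apply: spanZ; apply: f2.
apply/eqP; rewrite -subr_eq0 addrC -scaleN1r -gr_symbolZD // scaleN1r addrC; apply/eqP.
apply/gr_symbol_eq0; last exact: H.
by apply: filtration_le H.
Qed.

(** A word of length [d] is straightened in the graded ring; lifting the result changes it by an
    element of filtration degree [d - 1], to which induction applies. *)
Lemma filtration_span d c : filtration x d c ->
  span [set u | exists2 T, level_transversal lev T && (#|T| <= d)%N & u = \prod_(i in T) x i] c.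
Proof.
elim/ltn_ind: d c => d IHd; apply: span_ind => [|a _ c [w [wd ->]] hc]; first exact: span0.
apply: spanD => //; apply: spanZ.
have mono d' : (d' <= d)%N -> 
    span [set u | exists2 T, level_transversal lev T && (#|T| <= d')%N & u = \prod_(i in T) x i]
    `<=` span [set u | exists2 T, level_transversal lev T && (#|T| <= d)%N & u = \prod_(i in T) x i].
  move=> d'd; apply: span_mono => u [T /andP[tT Td] ->]; exists T => //.
  by rewrite tT (leq_trans Td).
case: (ltnP (size w) d) => [lt_wd|ge_wd].
  by apply: (mono _ (ltnW lt_wd)); apply: IHd => //; apply: filtration_word.
have {wd ge_wd} wd : size w = d by apply/eqP; rewrite eqn_leq wd.
have := straightening gr_gen_sq gr_gen_pair (P := pred0) w (fun i k => ltac:(by [])).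
move=> str; have {str} : span [set u | exists2 T, level_transversal lev T && (#|T| == d) &
    u = \prod_(i in T) e i] (\prod_(i <- w) e i).
  apply: span_mono str => u [T [tT sT _ ->]]; exists T => //.
  by rewrite tT sT wd eqxx.
move=> /span_eT[a' wE].
have hT (T : {set 'I_n}) : level_transversal lev T && (#|T| == d) ->
    filtration x d (\prod_(i in T) x i).
  by move=> /andP[_ /eqP<-]; apply: filtration_set.
have [hs symE] := gr_symbol_sum (index_enum _) a' hT.
have fw : filtration x d (\prod_(i <- w) x i) by apply: filtration_word; rewrite wd.
have : filtration_pred x d (\prod_(i <- w) x i -
    \sum_(T | level_transversal lev T && (#|T| == d)) a' T *: \prod_(i in T) x i).
  apply/gr_symbol_eq0; first by apply: spanD => //; apply: spanN.
  rewrite addrC -scaleN1r gr_symbolZD // symE scaleN1r addrC.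
  apply/eqP; rewrite subr_eq0; apply/eqP.
  transitivity (\prod_(i <- w) e i); first by rewrite /e prod_gr_gen wd.
  by rewrite wE; apply: eq_bigr => T /andP[_ /eqP sT]; rewrite /e prod_gr_gen_set sT.
set s := (X in _ - X) => hd.
have span_s :
    span [set u | exists2 T, level_transversal lev T && (#|T| <= d)%N & u = \prod_(i in T) x i] s.
  rewrite /s; elim/big_ind: _ => [||T /andP[tT /eqP sT]].
  - exact: span0.
  - exact: spanD.
  - by apply: spanZ; apply: mem_span; exists T; rewrite // tT sT leqnn.
rewrite -[X in span _ X](subrK s); apply: spanD => //.
move: (_ - s) hd => z hd; clear - IHd mono hd.
case: d hd IHd mono => [->|d hd IHd mono]; first by move=> *; apply: span0.
by apply: (mono d) => //; apply: IHd.
Qed.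

(** In degree [d] the relation puts a combination of monomials of size [d] into [F_(d-1)]. By
    [filtration_span] it equals a combination of smaller transversal monomials, and independence in
    [V] applies to the difference [cb]. *)
Lemma gr_gen_indep (c : {set 'I_n} -> F) :
  \sum_(T | level_transversal lev T) c T *: (\prod_(i in T) e i) = 0 ->
  forall T, level_transversal lev T -> c T = 0.
Proof.
move=> c0 T0 tT0; pose d := #|T0|.
pose q (T : {set 'I_n}) := insubd (0 : rees x) ((\prod_(i in T) x i) *: 'X^#|T|).
have valE T : val (rees_const x (c T) * q T) = (c T *: \prod_(i in T) x i) *: 'X^#|T|.
  rewrite rmorphM /= gr_symbol_val; last exact: filtration_set.
  by rewrite mul_polyC scalerA -scalerAl mul1r.
have {c0} : gr_class (\sum_(T | level_transversal lev T) rees_const x (c T) * q T) = 0.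
  rewrite -[RHS]c0 rmorph_sum; apply: eq_bigr => T _.
  by rewrite /e prod_gr_gen_set gr_class_scale.
move=> /gr_class_eq0/(_ d); rewrite raddf_sum coef_sum.
rewrite (eq_bigr (fun T : {set 'I_n} =>
    if #|T| == d then c T *: \prod_(i in T) x i else 0)); last first.
  move=> T _; transitivity (val (rees_const x (c T) * q T))`_d => //.
  rewrite valE coefZ coefXn eq_sym.
  by case: eqP => _; rewrite ?mulr1 // mulr0.
rewrite -big_mkcondr /= => hd.
have [b bE] : exists b : {set 'I_n} -> F,
    \sum_(T | level_transversal lev T && (#|T| == d)) c T *: \prod_(i in T) x i =
    \sum_(T | level_transversal lev T && (#|T| < d)%N) b T *: \prod_(i in T) x i.
  apply: span_eT; case: (d) hd => [->|d' /filtration_span//].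
  exact: span0.
pose cb (T : {set 'I_n}) := (if #|T| == d then c T else 0) - (if (#|T| < d)%N then b T else 0).
have cb0 : \sum_(T | level_transversal lev T) cb T *: \prod_(i in T) x i = 0.
  under eq_bigr do rewrite /cb scalerBl.
  rewrite sumrB; apply/eqP; rewrite subr_eq0; apply/eqP.
  transitivity (\sum_(T | level_transversal lev T && (#|T| == d)) c T *: \prod_(i in T) x i).
    by rewrite big_mkcondr /=; apply: eq_bigr => T _; case: ifP => _; rewrite ?scale0r.
  by rewrite bE big_mkcondr /=; apply: eq_bigr => T _; case: ifP => _; rewrite ?scale0r.
by have := x_indep cb0 tT0; rewrite /cb /d eqxx ltnn subr0.
Qed.

Lemma gr_gen_span (a : gr_sga x) : span [set u | exists w, u = \prod_(i <- w) e i] a.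
Proof.
have [m [c [hc ->]]] := sga_hom_cover a; apply: span_sum => d.
apply: span_mono (gr_hom_span (hc d)) => u [w [_ ->]].
by exists w.
Qed.

Lemma gr_irrelevant (a : gr_sga x) : irrelevant_ideal a <-> gen_ideal e xpredT a.
Proof.
split=> [[m [c [hc ->]]]|[c ->]]; last first.
  elim/big_ind: _ => [||i _]; [exact: irrelevant0|exact: irrelevantD|].
  by apply: irrelevantMr; exists (x i), (Rees (gr_genP x i)).
apply: gen_ideal_sum => d _; move: (c d) (gr_hom_span (hc d)); apply: span_ind.
  exact: gen_ideal0.
move=> a' _ u [[|i w] [wd ->]] hu //; apply: gen_idealD => //; apply: gen_idealZ.
by rewrite big_cons mulrC; apply: gen_idealMl; apply: gen_ideal_gen.
Qed.

(** Once the generators are sorted by level, both sides of [colon_gen_ideal] become ideals of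
    initial segments. *)
Lemma koszul_gr : koszul (gr_sga x).
Proof.
pose leL := [rel i j : 'I_n | (lev i <= lev j)%N].
pose s := sort leL (enum 'I_n).
have tL : transitive leL by move=> i j k; apply: leq_trans.
have rL : reflexive leL by move=> i; apply: leqnn.
have sL : sorted leL s by apply: sort_sorted => i j; apply: leq_total.
have ss : size s = n by rewrite size_sort size_enum_ord.
have us : uniq s by rewrite sort_uniq enum_uniq.
have ms i : i \in s by rewrite mem_sort mem_enum.
pose pos i := index i s.
have posn i : (pos i < n)%N by rewrite -ss index_mem.
have ex_pos j : (j < n)%N -> exists i, pos i = j.
  by move=> jn; exists (nth (Ordinal jn) s j); rewrite /pos index_uniq ?ss.
(* The default [0] is homogeneous of every degree, so [e' j] is linear also for [j] beyond [n]. *)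
pose e' j := nth 0 (map e s) j.
have e'E i : e' (pos i) = e i by rewrite /e' (nth_map i) ?index_mem // nth_index.
have e'_lin j : sga_hom 1 (e' j).
  have [jn|jn] := ltnP j n; last first.
    by rewrite /e' nth_default ?size_map ?ss //; apply: sga_hom0.
  have [i <-] := ex_pos j jn; rewrite e'E.
  by exists (x i), (Rees (gr_genP x i)).
have idealE j a : (j <= n)%N -> prefix_ideal e' j a <-> gen_ideal e (fun i => (pos i < j)%N) a.
  move=> jn; split=> [[c ->]|[c ->]].
    apply: gen_ideal_sum => t _; apply: gen_idealMl.
    have [i it] := ex_pos t (leq_trans (ltn_ord t) jn).
    by rewrite -it e'E; apply: gen_ideal_gen; rewrite it.
  elim/big_ind: _ => [||i ij]; [exact: prefix_ideal0|exact: prefix_idealD|].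
  by apply: prefix_idealMl; rewrite -e'E; apply: prefix_ideal_gen.
(* The first position of level above that of the [j]-th generator, or [n] if there is none, since
   [find] then returns the size. *)
pose b j := find (fun k => (nth 0%N (map lev s) j < lev k)%N) s.
have posb i k : (lev k <= lev i)%N = (pos k < b (pos i))%N.
  rewrite /b (nth_map i) ?index_mem // nth_index //; apply/idP/idP => [ki|kb].
    rewrite ltnNge; apply/negP => bk.
    have hb : has (fun k => (lev i < lev k)%N) s.
      by rewrite has_find; apply: leq_ltn_trans bk _; rewrite index_mem.
    have := nth_find i hb; apply/negP; rewrite -leqNgt; apply: leq_trans _ ki.
    have H := sorted_leq_nth tL rL i sL; rewrite has_find in hb.
    have kin : pos k \in [pred m | (m < size s)%N] by rewrite inE index_mem.
    by have := H _ _ hb kin bk; rewrite /pos nth_index.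
  have := before_find i kb; rewrite nth_index //.
  by move/negbT; rewrite -leqNgt.
apply: (@koszul_of_linear_quotients _ _ n e' b) => //.
- by move=> j _; rewrite -ss find_size.
- move=> j a jn; have [i ij] := ex_pos j jn; rewrite -ij e'E.
  rewrite idealE; last by rewrite ij ltnW.
  rewrite idealE; last by rewrite -ss find_size.
  have -> : (fun k => (pos k < b (pos i))%N) = (fun k => (lev k <= lev i)%N).
    by apply: boolp.funext => k; rewrite posb.
  (* Because [s] is sorted by level, the segment before [i] is closed under passing to lower levels
     and contains every generator of level below that of [i]. *)
  apply: (colon_gen_ideal gr_gen_sq gr_gen_pair gr_gen_span gr_gen_indep).
  + move=> k k' kpos k'k; apply: leq_ltn_trans kpos; rewrite leqNgt; apply/negP => lt_pos.
    have := sorted_ltn_index tL sL _ _ (ms k) (ms k') lt_pos.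
    by rewrite /= leqNgt k'k.
  + by rewrite ltnn.
  + move=> k ki; rewrite ltnNge leq_eqVlt; apply/negP => /orP[/eqP pik|lt_pos].
      have ik : i = k by rewrite -(nth_index i (ms i)) -(nth_index i (ms k)) -/(pos i) pik.
      by rewrite ik ltnn in ki.
    have := sorted_ltn_index tL sL _ _ (ms i) (ms k) lt_pos.
    by rewrite /= leqNgt ki.
- move=> a; rewrite gr_irrelevant idealE //.
  have -> // : (fun k => (pos k < n)%N) = xpredT by apply: boolp.funext => k; rewrite posn.
Qed.

End AssociatedGraded.

(** * Relations between Heaviside functions *)

(** For [p, q > 0] the sign patterns excluded by [w = p * u + q * v] give
    [s u * s v * (1 - s w) = 0] and [(1 - s u) * (1 - s v) * s w = 0]; in their sum the cubic terms
    cancel. The other cases follow by replacing [s] with [1 - s] for each negative coefficient. *)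
Lemma sign_relation (R : realFieldType) (F : fieldType) (p q : R) : p != 0 -> q != 0 ->
  exists a b c0 c1 c2 c3 : F, forall u v w : R, u != 0 -> v != 0 -> w != 0 ->
    w = p * u + q * v -> let s (t : R) : F := (0 < t)%R%:R in
    s u * s v = a * (s w * s u) + b * (s w * s v) + (c0 + c1 * s u + c2 * s v + c3 * s w).
Proof.
have signP (t : R) : t != 0 -> 0 < t /\ (0 < t) = true \/ t < 0 /\ (0 < t) = false.
  rewrite neq_lt => /orP[t0|t0]; last by left.
  by right; split=> //; apply: negbTE; rewrite -leNgt ltW.
move=> /signP[[p_gt _]|[p_lt _]] /signP[[q_gt _]|[q_lt _]].
- exists 1, 1, 0, 0, 0, (-1) => u v w /=.
  by move=> /signP[[? ->]|[? ->]] /signP[[? ->]|[? ->]] /signP[[? ->]|[? ->]] E /=;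
    first [ring | exfalso; nra].
- exists (-1), 1, 0, 1, 0, 0 => u v w /=.
  by move=> /signP[[? ->]|[? ->]] /signP[[? ->]|[? ->]] /signP[[? ->]|[? ->]] E /=;
    first [ring | exfalso; nra].
- exists 1, (-1), 0, 0, 1, 0 => u v w /=.
  by move=> /signP[[? ->]|[? ->]] /signP[[? ->]|[? ->]] /signP[[? ->]|[? ->]] E /=;
    first [ring | exfalso; nra].
- exists (-1), (-1), (-1), 1, 1, 1 => u v w /=.
  by move=> /signP[[? ->]|[? ->]] /signP[[? ->]|[? ->]] /signP[[? ->]|[? ->]] E /=;
    first [ring | exfalso; nra].
Qed.

Section HeavisideRelations.
Variables (R : realType) (l : nat) (A : arrangement R l) (F : fieldType).
Local Notation n := (nhyp A).
Local Notation x := (@heaviside R l A F).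
Implicit Types i j k : 'I_n.

(** Heaviside functions are idempotent, so their squares drop to filtration degree 1. *)
Lemma heaviside_sq i : filtration x 1 (x i * x i).
Proof.
have -> : x i * x i = x i; last exact: filtration_gen.
apply: boolp.funext => C; have [y [hy ->]] := chamber_exists C.
transitivity (x i (chamber_of hy) * x i (chamber_of hy)) => //.
by rewrite heaviside_chamber_of; case: ltP => _; rewrite ?mulr1 ?mulr0.
Qed.

(** With points [p], [q] dual to the normals of [i] and [j], subtracting the corresponding
    combination moves any [y] into the intersection, where the form of [k] vanishes. A zero
    coefficient would make [k] equal to [i] or [j]. *)
Lemma normal_combination i j k : i != j -> k != i -> k != j ->
  hyperplane i `&` hyperplane j `<=` hyperplane k -> exists a b : R, [/\ a != 0, b != 0 &
    forall y, dot (normal k) y = a * dot (normal i) y + b * dot (normal j) y].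
Proof.
have dual (s t : 'I_n) : s != t -> exists2 p, dot (normal s) p = 1 & dot (normal t) p = 0.
  move=> st; have [p tp sp] : exists2 p, hyperplane t p & ~ hyperplane s p.
    apply: contrapT => H; case/eqP: st; apply/esym; apply: hyperplane_sub_inj => p tp.
    by apply: contrapT => sp; apply: H; exists p.
  exists ((dot (normal s) p)^-1 *: p); rewrite dotZr.
    by rewrite mulVf //; apply/eqP.
  by rewrite tp mulr0.
move=> ij ki kj sub; have [p pi pj] := dual _ _ ij.
have [q qj qi] : exists2 q, dot (normal j) q = 1 & dot (normal i) q = 0.
  by apply: dual; rewrite eq_sym.
have kE y : dot (normal k) y =
    dot (normal k) p * dot (normal i) y + dot (normal k) q * dot (normal j) y.
  have : hyperplane k (y - (dot (normal i) y *: p + dot (normal j) y *: q)).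
    apply: sub; split; rewrite /hyperplane /hyp /= dotBr dotDr !dotZr.
      by rewrite pi qi mulr1 mulr0 addr0 subrr.
    by rewrite pj qj mulr1 mulr0 add0r subrr.
  rewrite /hyperplane /hyp /= dotBr dotDr !dotZr => /eqP; rewrite subr_eq0 => /eqP->.
  by rewrite mulrC [X in _ + X]mulrC.
exists (dot (normal k) p), (dot (normal k) q); split=> //.
  apply: contra kj => /eqP kp; apply/eqP/esym; apply: hyperplane_sub_inj => y yj.
  by rewrite /hyperplane /hyp /= kE kp mul0r add0r yj mulr0.
apply: contra ki => /eqP kq; apply/eqP/esym; apply: hyperplane_sub_inj => y yi.
by rewrite /hyperplane /hyp /= kE kq mul0r addr0 yi mulr0.
Qed.

(** On each chamber this is [sign_relation] for the three linear forms; the error term is affine in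
    the Heaviside functions, hence of filtration degree 1. *)
Lemma heaviside_pair i j k : i != j -> k != i -> k != j ->
  hyperplane i `&` hyperplane j `<=` hyperplane k -> exists a b : F,
  filtration x 1 (x i * x j - (a *: (x k * x i) + b *: (x k * x j))).
Proof.
move=> ij ki kj /(normal_combination ij ki kj)[p [q [p0 q0 kE]]].
suff [a [b [c0 [c1 [c2 [c3 H]]]]]] : exists a b c0 c1 c2 c3 : F, forall y,
    arr_complement A y -> let s (t : 'I_n) : F := (0 < dot (normal t) y)%R%:R in
    s i * s j = a * (s k * s i) + b * (s k * s j) + (c0 + c1 * s i + c2 * s j + c3 * s k).
  exists a, b; have -> : x i * x j - (a *: (x k * x i) + b *: (x k * x j)) =
      c0 *: 1 + c1 *: x i + c2 *: x j + c3 *: x k.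
    apply/eqP; rewrite subr_eq addrC; apply/eqP; apply: boolp.funext => C.
    have [y [hy ->]] := chamber_exists C; have := H y hy.
    rewrite /= -!(heaviside_chamber_of F) => E.
    transitivity (x i (chamber_of hy) * x j (chamber_of hy)) => //.
    by rewrite E -[c0 in LHS]mulr1.
  have f1 : filtration x 1 1 by apply: filtration_le (filtration1 x).
  by do ![apply: spanD|apply: spanZ => //]; apply: filtration_gen.
have [a [b [c0 [c1 [c2 [c3 H]]]]]] := sign_relation F p0 q0.
exists a, b, c0, c1, c2, c3 => y /arr_complementP hy; exact: H.
Qed.

End HeavisideRelations.

Theorem theorem1p3 (F : fieldType) (R : realType) (l : nat)
    (A : arrangement R l) :
  supersolvable (intersection_lattice A) -> koszul (VG_gr A F).
Proof.
move=> /supersolvable_levels[lev [lev_pair lev_line]].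
apply: (@koszul_gr _ _ _ _ lev).
- exact: heaviside_sq.
- move=> i j ij lij; have [k ki sub] := lev_pair i j ij lij.
  have nki : k != i by apply: contraTneq ki => ->; rewrite ltnn.
  have nkj : k != j by apply: contraTneq ki => ->; rewrite lij ltnn.
  by have [a [b H]] := heaviside_pair F ij nki nkj sub; exists k, a, b.
- exact: heaviside_independent.
Qed.
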